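(* Let $\mathbb{P}$ and $\mathbb{O}$ be finite quantum spaces and let $T\colon C(\mathbb{O})\otimes C(\mathbb{O})\to C(\mathbb{P})\otimes C(\mathbb{P})$ be a realizable $(\mathbb{P},\mathbb{O})$-correlation with realization $(\Phi_1,\Phi_2,\omega_\xi)$, where $\Phi_1,\Phi_2\colon C(\mathbb{O})\to C(\mathbb{P})\otimes B(H)$ are unital $*$-homomorphisms commuting on the second leg, i.e. $\Phi_1(x)_{13}\Phi_2(y)_{23}=\Phi_2(y)_{23}\Phi_1(x)_{13}$ for all $x,y\in C(\mathbb{O})$, $\xi\in H$ is a unit vector and $\omega_\xi$ is the corresponding vector state; thus $T(x\otimes y)=(\mathrm{id}\otimes\mathrm{id}\otimes\omega_\xi)(\Phi_1(x)_{13}\Phi_2(y)_{23})$ for all $x,y\in C(\mathbb{O})$. Let $U^{l,st}_{k,ij},W^{l,st}_{k,ij}\in B(H)$ be defined by $$\Phi_1(e^k_{ij})=\sum_{l,s,t}f^l_{st}\otimes U^{l,st}_{k,ij},\qquad \Phi_2(e^k_{ij})=\sum_{l,s,t}f^l_{st}\otimes W^{l,st}_{k,ij},\qquad k=1,\dots,N_{\mathbb{O}},\ i,j=1,\dots,n_k.$$ Assume that $T$ is synchronous. Then: (1) $W^{l,st}_{k,ij}\xi=\bigl(U^{l,st}_{k,ij}\bigr)^*\xi$ for all $k,l,i,j,s,t$; (2) the restriction of $\omega_\xi$ to the C*-algebra generated by all the $W^{l,st}_{k,ij}$ is a trace; (3) the restriction of $\omega_\xi$ to the C*-algebra generated by all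 the $U^{l,st}_{k,ij}$ is a trace. Moreover, the state $\tau=\omega_\xi\circ\Lambda_1$ on $C(\mathbb{M}_{\mathbb{P},\mathbb{O}})$, where $\Lambda_1\colon C(\mathbb{M}_{\mathbb{P},\mathbb{O}})\to B(H)$ is the unique unital $*$-homomorphism such that $\Phi_1=(\mathrm{id}\otimes\Lambda_1)\circ\boldsymbol{\Phi}_{\mathbb{P},\mathbb{O}}$, is a trace and $T=T_\tau$.
   Context: A quantum space $\mathbb{X}$ is an object of the category dual to the category of C*-algebras; the corresponding C*-algebra is denoted $C_0(\mathbb{X})$, or $C(\mathbb{X})$ when it is unital; $\mathbb{X}$ is compact if $C(\mathbb{X})$ is unital and finite if $C(\mathbb{X})$ is finite-dimensional. $\mathrm{Mor}(A,B)$ is the set of non-degenerate $*$-homomorphisms $A\to M(B)$ (multiplier algebra). $\otimes$ is the minimal tensor product. For $\mathbb{P}$ finite and $\mathbb{O}$ compact, $(C(\mathbb{M}_{\mathbb{P},\mathbb{O}}),\boldsymbol{\Phi}_{\mathbb{P},\mathbb{O}})$ denotes the (existing, unique up to isomorphism) pair consisting of a unital C*-algebra and a unital $*$-homomorphism $\boldsymbol{\Phi}_{\mathbb{P},\mathbb{O}}\colon C(\mathbb{O})\to C(\mathbb{P})\otimes C(\mathbb{M}_{\mathbb{P},\mathbb{O}})$ with the universal property: for every quantum space $\mathbb{X}$ and every $\Psi\in\mathrm{Mor}(C(\mathbb{O}),C(\mathbb{P})\otimes C_0(\mathbb{X}))$ there is a unique $\Lambda\in\mathrm{Mor}(C(\mathbb{M}_{\mathbb{P},\mathbb{O}}),C_0(\mathbb{X}))$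 with $\Psi=(\mathrm{id}\otimes\Lambda)\circ\boldsymbol{\Phi}_{\mathbb{P},\mathbb{O}}$. The C*-algebra $C(\mathbb{M}_{\mathbb{P},\mathbb{O}})$ is generated by $\{(\omega\otimes\mathrm{id})\boldsymbol{\Phi}_{\mathbb{P},\mathbb{O}}(a) : a\in C(\mathbb{O}),\ \omega\in C(\mathbb{P})^*\}$. Fix decompositions $C(\mathbb{P})=\bigoplus_{l=1}^{N_{\mathbb{P}}}\mathrm{Mat}_{m_l}(\mathbb{C})$ and $C(\mathbb{O})=\bigoplus_{k=1}^{N_{\mathbb{O}}}\mathrm{Mat}_{n_k}(\mathbb{C})$ with matrix units $f^{l}_{st}$ ($1\le l\le N_{\mathbb{P}}$, $1\le s,t\le m_l$) and $e^{k}_{ij}$ ($1\le k\le N_{\mathbb{O}}$, $1\le i,j\le n_k$). A $(\mathbb{P},\mathbb{O})$-correlation is a unital completely positive map $T\colon C(\mathbb{O})\otimes C(\mathbb{O})\to C(\mathbb{P})\otimes C(\mathbb{P})$. Its coefficients $X^{l,st;\,l',s't'}_{k,ij;\,k',i'j'}\in\mathbb{C}$ are defined by $T(e^k_{ij}\otimes e^{k'}_{i'j'})=\sum_{l,l',s,t,s',t'}X^{l,st;\,l',s't'}_{k,ij;\,k',i'j'}\,f^l_{st}\otimes f^{l'}_{s't'}$. $T$ is called synchronous if $\sum_{k,l,i,j,s,t}\frac{1}{n_km_l}X^{l,st;\,l,st}_{k,ij;\,k,ij}=N_{\mathbb{P}}$. Leg numbering: for $z=\sum a\otimes b\in C(\mathbb{P})\otimes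 B(H)$, $z_{13}=\sum a\otimes\mathbb{1}\otimes b$ and $z_{23}=\sum\mathbb{1}\otimes a\otimes b$ in $C(\mathbb{P})\otimes C(\mathbb{P})\otimes B(H)$. Define $V^{l,st}_{k,ij}\in C(\mathbb{M}_{\mathbb{P},\mathbb{O}})$ by $\boldsymbol{\Phi}_{\mathbb{P},\mathbb{O}}(e^k_{ij})=\sum_{l,s,t}f^l_{st}\otimes V^{l,st}_{k,ij}$. For a tracial state $\tau$ on $C(\mathbb{M}_{\mathbb{P},\mathbb{O}})$, $T_\tau$ is the $(\mathbb{P},\mathbb{O})$-correlation determined by $$T_\tau(e^k_{ij}\otimes e^{k'}_{i'j'})=\sum_{s,t,s',t',l,l'}\tau\bigl(V^{l,st}_{k,ij}V^{l',t's'}_{k',j'i'}\bigr)\,f^l_{st}\otimes f^{l'}_{s't'} .$$ *)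

(* Defs.v *)
From HB Require Import structures.
From mathcomp Require Import all_boot all_order all_algebra complex.
From mathcomp Require Import mathcomp_extra boolp classical_sets functions reals.
From mathcomp Require Import topology normedtype ring lra.

Set Implicit Arguments.
Unset Strict Implicit.
Unset Printing Implicit Defensive.

Import Order.TTheory GRing.Theory Num.Theory.
Import numFieldNormedType.Exports.

Local Open Scope classical_set_scope.
Local Open Scope ring_scope.
Local Open Scope complex_scope.

Reserved Notation "a ** b" (at level 40, left associativity).

HB.mixin Record Lmodule_isStarAlg (C : numClosedFieldType) A & GRing.Lmodule C A := {
  smul : A -> A -> A;
  star : A -> A;
  smulA : associative smul;
  smulDl : left_distributive smul +%R;
  smulDr : right_distributive smul +%R;
  smulZl : forall (c : C) a b, smul (c *: a) b = c *: smul a b;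
  smulZr : forall (c : C) a b, smul a (c *: b) = c *: smul a b;
  starK : involutive star;
  starD : {morph star : a b / a + b};
  starZ : forall (c : C) a, star (c *: a) = Num.conj c *: star a;
  starM : forall a b, star (smul a b) = smul (star b) (star a)
}.

#[short(type="starAlgType")]
HB.structure Definition StarAlg (C : numClosedFieldType) :=
  {A of GRing.Lmodule C A & Lmodule_isStarAlg C A}.

Notation "a ** b" := (smul a b) : ring_scope.

HB.mixin Record StarAlg_isUnital (C : numClosedFieldType) A & StarAlg C A := {
  sone : A;
  smul1l : left_id sone (@smul C A);
  smul1r : right_id sone (@smul C A)
}.

#[short(type="ustarAlgType")]
HB.structure Definition UStarAlg (C : numClosedFieldType) :=
  {A of StarAlg C A & StarAlg_isUnital C A}.

#[short(type="topStarAlgType")]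
HB.structure Definition TopStarAlg (C : numClosedFieldType) :=
  {A of StarAlg C A & Topological A}.

HB.mixin Record StarAlg_isCStar (C : numClosedFieldType) A
    & StarAlg C A & CompleteNormedModule C A := {
  cstar_normM : forall a b : A, `|a ** b| <= `|a| * `|b|;
  cstar_norm : forall a : A, `|star a ** a| = `|a| ^+ 2
}.

#[short(type="cstarAlgType")]
HB.structure Definition CStarAlg (C : numClosedFieldType) :=
  {A of StarAlg C A & CompleteNormedModule C A & StarAlg_isCStar C A}.

#[short(type="ucstarAlgType")]
HB.structure Definition UCStarAlg (C : numClosedFieldType) :=
  {A of CStarAlg C A & UStarAlg C A}.

HB.mixin Record NormedModule_isHilbert (C : numClosedFieldType) H
    & CompleteNormedModule C H := {
  inner : H -> H -> C;
  innerDl : forall x y z, inner (x + y) z = inner x z + inner y z;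
  innerZl : forall c x y, inner (c *: x) y = c * inner x y;
  innerC : forall x y, inner y x = Num.conj (inner x y);
  inner_norm : forall x, inner x x = `|x| ^+ 2
}.

#[short(type="hilbertType")]
HB.structure Definition Hilbert (C : numClosedFieldType) :=
  {H of CompleteNormedModule C H & NormedModule_isHilbert C H}.

Section InnerTheory.
Context {C : numClosedFieldType} {H : hilbertType C}.
Implicit Types (x y z : H) (c : C).

Lemma innerDr x y z : inner z (x + y) = inner z x + inner z y.
Proof. by rewrite innerC innerDl rmorphD /= -!innerC. Qed.

Lemma innerZr c x y : inner y (c *: x) = Num.conj c * inner y x.
Proof. by rewrite innerC innerZl rmorphM /= -innerC. Qed.

Lemma inner0l x : inner 0 x = 0.
Proof. by rewrite -(scale0r (0 : H)) innerZl mul0r. Qed.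

Lemma inner0r x : inner x 0 = 0.
Proof. by rewrite innerC inner0l rmorph0. Qed.

Lemma innerNl x y : inner (- x) y = - inner x y.
Proof. by rewrite -scaleN1r innerZl mulN1r. Qed.

Lemma innerNr x y : inner x (- y) = - inner x y.
Proof. by rewrite innerC innerNl rmorphN /= -innerC. Qed.

Lemma innerBl x y z : inner (x - y) z = inner x z - inner y z.
Proof. by rewrite innerDl innerNl. Qed.

Lemma innerBr x y z : inner z (x - y) = inner z x - inner z y.
Proof. by rewrite innerDr innerNr. Qed.

Lemma inner_eq0 x : (forall y, inner y x = 0) -> x = 0.
Proof.
by move=> /(_ x); rewrite inner_norm => /eqP; rewrite expf_eq0 /= normr_eq0 => /eqP.
Qed.

Lemma inner_ext x x' : (forall y, inner y x = inner y x') -> x = x'.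
Proof.
by move=> h; apply/subr0_eq/inner_eq0 => y; rewrite innerBr h subrr.
Qed.

Lemma cauchy_schwarz x y : `|inner x y| <= `|x| * `|y|.
Proof.
have [->|y0] := eqVneq y 0; first by rewrite inner0r !normr0 mulr0.
have ny0 : 0 < `|y| by rewrite normr_gt0.
rewrite -(@ler_pXn2r _ 2) ?nnegrE ?mulr_ge0 //.
pose a := `|y| ^+ 2; have a0 : 0 < a by rewrite exprn_gt0.
have aR : Num.conj a = a by rewrite conj_Creal // realX // normr_real.
have : 0 <= inner (a *: x - inner x y *: y) (a *: x - inner x y *: y).
  by rewrite inner_norm exprn_ge0.
rewrite innerBl !innerBr !innerZl !innerZr aR !inner_norm (innerC x y) -/a.
rewrite -[Num.conj (inner x y) * a]mulrC.
set w := inner x y.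
rewrite exprMn normCK -/w.
have -> : a * (a * `|x| ^+ 2) - a * (Num.conj w * w) -
  (w * (a * Num.conj w) - w * (a * Num.conj w)) = a * (`|x| ^+ 2 * a - w * Num.conj w).
  by rewrite subrr subr0 mulrBr [Num.conj w * w]mulrC [_ * a]mulrC.
by rewrite pmulr_rge0 // subr_ge0.
Qed.

End InnerTheory.

Section Riesz.
Context {R : realType} {H : hilbertType R[i]}.
Implicit Types (x y z : H).

Let n x : R := complex.Re `|x|.
Let ri x y : R := complex.Re (inner x y).

Let nE x : `|x| = (n x)%:C.
Proof. by rewrite RRe_real // normr_real. Qed.

Let n_ge0 x : 0 <= n x. Proof. by rewrite -lecR -nE normr_ge0. Qed.

Let ReD (a b : R[i]) : complex.Re (a + b) = complex.Re a + complex.Re b.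
Proof. by case: a b => ? ? [? ?]. Qed.

Let ReJ (a : R[i]) : complex.Re (Num.conj a) = complex.Re a.
Proof. by case: a. Qed.

Let ReZ (t : R) (a : R[i]) : complex.Re (t%:C * a) = t * complex.Re a.
Proof. by case: a => a b /=; rewrite mul0r subr0. Qed.

Let ReB (a b : R[i]) : complex.Re (a - b) = complex.Re a - complex.Re b.
Proof. by case: a b => ? ? [? ?]. Qed.

Let n2 x : n x ^+ 2 = ri x x.
Proof. by rewrite /ri inner_norm nE -rmorphXn. Qed.

Let riC x y : ri x y = ri y x.
Proof. by rewrite /ri innerC ReJ. Qed.

Let n2D x y : n (x + y) ^+ 2 = n x ^+ 2 + n y ^+ 2 + 2 * ri x y.
Proof.
rewrite !n2 /ri innerDl !innerDr !ReD -/(ri _ _) -/(ri _ _) -/(ri x y) -/(ri y x).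
by rewrite (riC y x); ring.
Qed.

Let conjR (t : R) : Num.conj (t%:C) = t%:C :> R[i].
Proof. by apply: conj_Creal; rewrite complex_real. Qed.

Let riZ (t : R) x y : ri (t%:C *: x) y = t * ri x y.
Proof. by rewrite /ri innerZl ReZ. Qed.

Let n2Z (t : R) x : n (t%:C *: x) ^+ 2 = t ^+ 2 * n x ^+ 2.
Proof. by rewrite !n2 riZ riC riZ mulrA -expr2. Qed.

Let ri_le x y : `|ri x y| <= n x * n y.
Proof.
rewrite -lecR rmorphM /= -!nE.
exact: le_trans (normc_ge_Re _) (cauchy_schwarz _ _).
Qed.

Lemma riesz_representation (phi : H -> R[i]) (k : R) :
  (forall x y, phi (x + y) = phi x + phi y) ->
  (forall c x, phi (c *: x) = c * phi x) ->
  (forall x, `|phi x| <= k%:C * `|x|) ->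
  exists y, forall x, phi x = inner x y.
Proof.
move=> phiD phiZ phik; pose rphi x := complex.Re (phi x).
have rphiD x y : rphi (x + y) = rphi x + rphi y by rewrite /rphi phiD ReD.
have rphiZ (t : R) x : rphi (t%:C *: x) = t * rphi x by rewrite /rphi phiZ ReZ.
have rphi0 : rphi 0 = 0 by rewrite -(scale0r (0 : H)) (rphiZ 0) mul0r.
have rphi_le x : `|rphi x| <= k * n x.
  by rewrite -lecR rmorphM /= -nE; apply: le_trans (normc_ge_Re _) (phik _).
pose J x := n x ^+ 2 - 2 * rphi x.
have JD x z t : J (x + t%:C *: z) = J x + t ^+ 2 * n z ^+ 2
    + 2 * t * (ri z x - rphi z).
  by rewrite /J n2D n2Z rphiD rphiZ riC riZ; ring.
have Jlb x : - k ^+ 2 <= J x.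
  rewrite /J; have := rphi_le x; rewrite ler_norml => /andP[_ h].
  rewrite -subr_ge0; have -> : n x ^+ 2 - 2 * rphi x - - k ^+ 2 =
    (n x - k) ^+ 2 + 2 * (k * n x - rphi x) by ring.
  by rewrite addr_ge0 ?sqr_ge0 // mulr_ge0 // subr_ge0.
have hinf : has_inf (range J).
  by split; [exists (J 0), 0|exists (- k ^+ 2) => _ [x _ <-]].
pose d := inf (range J).
have dJ x : d <= J x by apply: ge_inf; [case: hinf | exists x].
have Jd (e : R) : 0 < e -> exists x, J x < d + e.
  by move=> e0; have [_ [x _ <-] h] := inf_adherent e0 hinf; exists x.
have var x e z : J x < d + e -> (ri z x - rphi z) ^+ 2 <= e * n z ^+ 2.
  move=> Jx; set c := _ - _; have h t : 0 < t ^+ 2 * n z ^+ 2 + 2 * t * c + e.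
    by have := dJ (x + t%:C *: z); rewrite JD -/c => ?; lra.
  have [z0|z0] := eqVneq z 0.
    by rewrite /c z0 /ri inner0l rphi0 subr0 /n normr0 /= !expr0n mulr0.
  have a0 : 0 < n z ^+ 2 by rewrite exprn_gt0 // -ltcR -nE normr_gt0.
  have := h (- c / n z ^+ 2); set a := _ ^+ 2 in a0 *.
  have -> : (- c / a) ^+ 2 * a + 2 * (- c / a) * c + e = (e * a - c ^+ 2) / a.
    by field; rewrite gt_eqF.
  by rewrite pmulr_lgt0 ?invr_gt0 // subr_gt0 => /ltW.
have par x y e : J x < d + e -> J y < d + e -> n (x - y) ^+ 2 <= 4 * e.
  move=> Jx Jy; have := dJ (2^-1%:C *: (x + y)).
  have -> : x - y = x + (- 1)%:C *: y by rewrite rmorphN1 scaleN1r.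
  rewrite n2D n2Z riC riZ (riC y) /J n2Z rphiZ n2D rphiD => h.
  by rewrite /J in Jx Jy; nra.
pose F : set_system H := filter_from [set e : R | 0 < e] (fun e => [set x | J x < d + e]).
have FF : ProperFilter F.
  apply: filter_from_proper; last by move=> e /= /Jd.
  apply: filter_from_filter; first by exists 1 => /=.
  move=> e e' /= e0 e0'; exists (Num.min e e') => /=; first by rewrite lt_min e0.
  by move=> x /= ; rewrite -ltrBlDl lt_min !ltrBlDl => /andP[].
have Fc : cauchy F.
  apply: cauchy_exP => /= e e0.
  have [r re r0] : exists2 r : R, e = r%:C & 0 < r.
    have eR : e \is Num.real by rewrite gtr0_real.
    exists (complex.Re e); first by rewrite RRe_real.
    by rewrite -ltcR RRe_real.
  have e'0 : 0 < r ^+ 2 / 8 by rewrite divr_gt0 // exprn_gt0.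
  have [x Jx] := Jd _ e'0; exists x; exists (r ^+ 2 / 8) => // y /= Jy.
  rewrite -ball_normE /ball_ /= nE re ltcR.
  rewrite -(@ltr_pXn2r _ 2) ?nnegrE ?n_ge0 ?(ltW r0) //.
  by apply: le_lt_trans (par _ _ _ Jx Jy) _; have := exprn_gt0 2 r0; lra.
have [x0 Fx0] : exists x0, F --> x0 by apply/cvg_ex; exact: cauchy_cvg.
have key z : rphi z = ri z x0.
  apply/eqP; rewrite eq_sym -subr_eq0 -normr_le0 leNgt; apply/negP; set c := `|_| => c0.
  pose e := c / (2 * n z + 1) / 2.
  have dz : 0 < 2 * n z + 1 by have := n_ge0 z; lra.
  have e0 : 0 < e by rewrite !divr_gt0.
  have Fe1 : F [set x | J x < d + e ^+ 2].
    by exists (e ^+ 2) => //=; rewrite exprn_gt0.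
  have Fe2 : F (ball x0 e%:C) by apply: Fx0; apply: nbhsx_ballx; rewrite ltcR.
  rewrite -ball_normE in Fe2.
  have [x [/= h1 h2]] := filter_ex (filterI Fe1 Fe2).
  have {}h2 : n (x0 - x) <= e by rewrite -lecR -nE ltW.
  have h3 : `|ri z x - rphi z| <= e * n z.
    have en0 : 0 <= e * n z by apply: mulr_ge0; [exact: ltW|exact: n_ge0].
    rewrite -(@ler_pXn2r _ 2) ?nnegrE //.
    by rewrite real_normK ?num_real // exprMn; apply: var.
  have h4 : `|ri z (x0 - x)| <= n z * e.
    by apply: le_trans (ri_le _ _) _; rewrite ler_wpM2l ?n_ge0.
  have : c <= 2 * e * n z.
    rewrite /c; have -> : ri z x0 - rphi z = ri z (x0 - x) + (ri z x - rphi z).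
      by rewrite /ri innerBr ReB; ring.
    have -> : 2 * e * n z = n z * e + e * n z by ring.
    exact: le_trans (ler_normD _ _) (lerD h4 h3).
  have -> : 2 * e * n z = c * (n z / (2 * n z + 1)) by rewrite /e; field; rewrite gt_eqF.
  rewrite -[X in X <= _]mulr1 ler_pM2l // ler_pdivlMr // mul1r.
  by have := n_ge0 z; lra.
exists x0 => x.
have h1 := key x; have := key ('i *: x).
rewrite /rphi /ri phiZ innerZl; move: h1; rewrite /rphi /ri.
case: (phi x) (inner x x0) => a b [a' b'] /= -> /eqP.
by rewrite !mul0r !mul1r !sub0r eqr_opp => /eqP ->.
Qed.

End Riesz.

Record bop (C : numClosedFieldType) (H : hilbertType C) := Bop {
  bop_fun :> H -> H;
  bop_linear : linear bop_fun;
  bop_continuous : continuous bop_fun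
}.

Section BopLmodule.
Context {C : numClosedFieldType} {H : hilbertType C}.
Implicit Types (S T : bop H) (x y : H).

HB.instance Definition _ := gen_eqMixin (bop H).
HB.instance Definition _ := gen_choiceMixin (bop H).

Lemma bopP S T : (forall x, S x = T x) -> S = T.
Proof.
case: S T => f fl fc [g gl gc] /= fg.
have {}fg : f = g by apply/funext.
by subst g; congr Bop; exact: Prop_irrelevance.
Qed.

Lemma bopD T x y : T (x + y) = T x + T y.
Proof. by have := bop_linear T 1 x y; rewrite !scale1r. Qed.

Lemma bop0 T : T 0 = 0.
Proof. by apply: (addrI (T 0)); rewrite -bopD !addr0. Qed.

Lemma bopZ T c x : T (c *: x) = c *: T x.
Proof. by have := bop_linear T c x 0; rewrite bop0 !addr0. Qed.

Lemma bopN T x : T (- x) = - T x.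
Proof. by rewrite -scaleN1r bopZ scaleN1r. Qed.

Lemma bopB T x y : T (x - y) = T x - T y.
Proof. by rewrite bopD bopN. Qed.

Definition bop_zero : bop H.
Proof.
exists (fun=> 0); first by move=> c x y; rewrite scaler0 addr0.
by move=> x; exact: cvg_cst.
Defined.

Definition bop_opp T : bop H.
Proof.
exists (fun x => - T x).
  by move=> c x y; rewrite bopD bopZ opprD scalerN.
by move=> x; apply: cvgN; exact: bop_continuous.
Defined.

Definition bop_add S T : bop H.
Proof.
exists (fun x => S x + T x).
  by move=> c x y; rewrite !bopD !bopZ scalerDr addrACA.
by move=> x; apply: cvgD; exact: bop_continuous.
Defined.

Definition bop_scale (c : C) T : bop H.
Proof.
exists (fun x => c *: T x).
  by move=> d x y; rewrite bopD bopZ scalerDr !scalerA mulrC.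
by move=> x; apply: cvgZr; exact: bop_continuous.
Defined.

Definition bop_id : bop H.
Proof. by exists (fun x => x) => // x; exact: cvg_id. Defined.

Definition bop_comp S T : bop H.
Proof.
exists (fun x => S (T x)); first by move=> c x y; rewrite !bopD !bopZ.
by move=> x; apply: (@continuous_comp _ _ _ T S); exact: bop_continuous.
Defined.

Fact bop_addA : associative bop_add.
Proof. by move=> S T U; apply: bopP => x /=; rewrite addrA. Qed.
Fact bop_addC : commutative bop_add.
Proof. by move=> S T; apply: bopP => x /=; rewrite addrC. Qed.
Fact bop_add0 : left_id bop_zero bop_add.
Proof. by move=> S; apply: bopP => x /=; rewrite add0r. Qed.
Fact bop_addN : left_inverse bop_zero bop_opp bop_add.
Proof. by move=> S; apply: bopP => x /=; rewrite addNr. Qed.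

HB.instance Definition _ :=
  GRing.isZmodule.Build (bop H) bop_addA bop_addC bop_add0 bop_addN.

Fact bop_scaleA a b T : bop_scale a (bop_scale b T) = bop_scale (a * b) T.
Proof. by apply: bopP => x /=; rewrite scalerA. Qed.
Fact bop_scale1 : left_id 1 bop_scale.
Proof. by move=> T; apply: bopP => x /=; rewrite scale1r. Qed.
Fact bop_scaleDr : right_distributive bop_scale +%R.
Proof. by move=> c S T; apply: bopP => x /=; rewrite scalerDr. Qed.
Fact bop_scaleDl T : {morph bop_scale^~ T : a b / a + b}.
Proof. by move=> a b; apply: bopP => x /=; rewrite scalerDl. Qed.

HB.instance Definition _ := GRing.Zmodule_isLmodule.Build C (bop H)
  bop_scaleA bop_scale1 bop_scaleDr bop_scaleDl.

Lemma bop_addE S T x : (S + T) x = S x + T x. Proof. by []. Qed.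
Lemma bop_oppE T x : (- T) x = - T x. Proof. by []. Qed.
Lemma bop_zeroE x : (0 : bop H) x = 0. Proof. by []. Qed.
Lemma bop_scaleE c T x : (c *: T) x = c *: T x. Proof. by []. Qed.

End BopLmodule.

Section BopCStar.
Context {R : realType} {H : hilbertType R[i]}.
Implicit Types (S T : bop H) (x y : H).

Let n x : R := complex.Re `|x|.

Let nE x : `|x| = (n x)%:C.
Proof. by rewrite RRe_real // normr_real. Qed.

Let n_ge0 x : 0 <= n x. Proof. by rewrite -lecR -nE normr_ge0. Qed.

Lemma bop_bounded T : exists2 k : R, 0 <= k & forall x, `|T x| <= k%:C * `|x|.
Proof.
pose L := GRing.isLinear.Build _ _ _ _ (T : H -> H) (bop_linear T).
pose f : {linear H -> H} := HB.pack (T : H -> H) L.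
have /linear_boundedP/pinfty_ex_gt0 [k k0 hk] : bounded_near f (nbhs (0 : H)).
  by apply/linear_bounded_continuous; exact: bop_continuous.
have kR : k \is Num.real by rewrite gtr0_real.
exists (complex.Re k); first by rewrite -lecR RRe_real // ltW.
by move=> x; rewrite RRe_real //; exact: hk.
Qed.

Lemma bounded_linear_bop (f : H -> H) (k : R) : linear f ->
  (forall x, `|f x| <= k%:C * `|x|) -> continuous f.
Proof.
move=> fl fk.
pose L := GRing.isLinear.Build _ _ _ _ f fl.
pose g : {linear H -> H} := HB.pack f L.
have kR : k%:C \is Num.real by rewrite complex_real.
suff : continuous g by [].
apply/linear_bounded_continuous/linear_boundedP.
exists k%:C; split=> // r kr x; apply: le_trans (fk x) _.
by rewrite ler_wpM2r // ltW.
Qed.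

(* Operator norm: the supremum of [`|T x|] over the unit ball. *)
Definition opnorm T : R := sup [set complex.Re `|T x| | x in [set x | `|x| <= 1]].

Let opset T := [set complex.Re `|T x| | x in [set x | `|x| <= 1]].

Let opset_sup T : has_sup (opset T).
Proof.
split; first by exists (n (T 0)), 0 => //=; rewrite normr0.
have [k k0 hk] := bop_bounded T; exists k => _ [x /= x1 <-].
rewrite -lecR -/(n _) -nE; apply: le_trans (hk x) _.
by rewrite -[leRHS]mulr1 ler_wpM2l // lecR.
Qed.

Lemma opnorm_ge0 T : 0 <= opnorm T.
Proof.
apply: (@le_trans _ _ (n (T 0))); first exact: n_ge0.
by apply: (sup_upper_bound (opset_sup T)); exists 0 => //=; rewrite normr0.
Qed.

Lemma opnormP T x : `|T x| <= (opnorm T)%:C * `|x|.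
Proof.
have [->|x0] := eqVneq x 0; first by rewrite bop0 !normr0 mulr0.
have nx0 : 0 < `|x| by rewrite normr_gt0.
have := sup_upper_bound (opset_sup T); move=> /(_ (n (T (`|x|^-1 *: x)))) h.
have {}h : n (T (`|x|^-1 *: x)) <= opnorm T.
  by apply: h; exists (`|x|^-1 *: x) => //=; rewrite normfZV.
move: h; rewrite -lecR -nE bopZ normrZ normfV normr_id mulrC.
by rewrite ler_pdivrMr.
Qed.

Lemma opnorm_le T (k : R) : 0 <= k ->
  (forall x, `|T x| <= k%:C * `|x|) -> opnorm T <= k.
Proof.
move=> k0 hk; apply: ge_sup; first by case: (opset_sup T).
move=> _ [x /= x1 <-]; rewrite -lecR -/(n _) -nE; apply: le_trans (hk x) _.
by rewrite -[leRHS]mulr1 ler_wpM2l // lecR.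
Qed.

Let bop_norm T : R[i] := (opnorm T)%:C.

Fact bop_normD S T : bop_norm (S + T) <= bop_norm S + bop_norm T.
Proof.
rewrite /bop_norm -rmorphD lecR; apply: opnorm_le.
  by rewrite addr_ge0 // opnorm_ge0.
move=> x; rewrite rmorphD mulrDl; apply: le_trans (ler_normD _ _) _.
by apply: lerD; exact: opnormP.
Qed.

Let bop_normZ_le (c : R[i]) (m : R) T : `|c| = m%:C ->
  opnorm (c *: T) <= m * opnorm T.
Proof.
move=> cE; apply: opnorm_le => [|x].
  by apply: mulr_ge0; [rewrite -lecR -cE; exact: normr_ge0|exact: opnorm_ge0].
rewrite rmorphM /= -cE normrZ -mulrA ler_wpM2l //.
exact: opnormP.
Qed.

Fact bop_normZ (c : R[i]) T : bop_norm (c *: T) = `|c| * bop_norm T.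
Proof.
have [m cE] : exists m : R, `|c| = m%:C.
  by exists (complex.Re `|c|); rewrite RRe_real // normr_real.
rewrite /bop_norm cE -rmorphM; congr (_%:C); apply/le_anti/andP; split.
  exact: bop_normZ_le.
have [c0|c0] := eqVneq c 0.
  have -> : m = 0 by apply: complexI; rewrite -cE c0 normr0.
  by rewrite mul0r opnorm_ge0.
have m0 : 0 < m by rewrite -ltcR -cE normr_gt0.
have := @bop_normZ_le c^-1 m^-1 (c *: T); rewrite scalerA mulVf // scale1r.
by rewrite mulrC ler_pdivlMr // mulrC; apply; rewrite normfV cE fmorphV.
Qed.

Fact bop_norm0_eq0 T : bop_norm T = 0 -> T = 0.
Proof.
move=> T0; apply: bopP => x; apply/eqP; rewrite -normr_le0.
by apply: le_trans (opnormP T x) _; rewrite -/(bop_norm T) T0 mul0r.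
Qed.

HB.instance Definition _ := Lmodule_isNormed.Build R[i] (bop H)
  bop_normD bop_normZ bop_norm0_eq0.

Lemma bop_normE T : `|T| = (opnorm T)%:C. Proof. by []. Qed.

Lemma bop_norm_ler T x : `|T x| <= `|T| * `|x|.
Proof. exact: opnormP. Qed.

Lemma bop_norm_le T (k : R[i]) : 0 <= k ->
  (forall x, `|T x| <= k * `|x|) -> `|T| <= k.
Proof.
move=> k0; have kE : k = (complex.Re k)%:C by rewrite RRe_real // ger0_real.
by rewrite kE bop_normE lecR in k0 * => h; rewrite lecR; exact: opnorm_le.
Qed.

Fact bop_complete (F : set_system (bop H)) : ProperFilter F -> cauchy F -> cvg F.
Proof.
move=> FF Fc.
have Fe (e : R[i]) : 0 < e -> exists T, F [set S | `|T - S| < e].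
  move=> e0; have /cauchyP /(_ e e0) [T FT] := Fc.
  by exists T; move: FT; rewrite -ball_normE.
have Fx x : exists l : H, (fun T : bop H => T x) @ F --> l.
  apply/cvg_ex; apply: cauchy_cvg; apply: cauchy_exP => e e0.
  have e'0 : 0 < e / (`|x| + 1) by rewrite divr_gt0 // ltr_wpDl.
  have [T FT] := Fe _ e'0; exists (T x).
  suff : F [set S : bop H | ball (T x) e (S x)] by [].
  apply: filterS FT => S /= TS.
  rewrite -ball_normE; suff : `|(T - S) x| < e by [].
  apply: le_lt_trans (bop_norm_ler _ _) _.
  rewrite ltr_pdivlMr ?ltr_wpDl // in TS; apply: le_lt_trans TS.
  by rewrite ler_wpM2l // lerDl.
have [f ff] := choice Fx.
have app_cvg x (e : R[i]) : 0 < e -> F [set T | `|f x - T x| < e].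
  by move=> e0; have /cvgrPdist_lt /(_ e e0) := ff x.
have fl : linear f.
  move=> c x y; apply: (@cvg_unique _ (@norm_hausdorff _ H) ((fun T : bop H => T (c *: x + y)) @ F)).
    exact: ff.
  have -> : (fun T : bop H => T (c *: x + y)) = (fun T : bop H => c *: T x + T y).
    by apply/funext => T; rewrite bopD bopZ.
  by apply: cvgD; [apply: cvgZr; exact: ff|exact: ff].
have key (e : R[i]) T : 0 < e -> F [set S | `|T - S| < e] ->
    forall x, `|f x - T x| <= e * `|x|.
  move=> e0 FT x; rewrite real_leNgt ?realM ?normr_real ?gtr0_real //.
  apply/negP; set d := `|f x - T x| => h.
  have d0 : 0 < d - e * `|x| by rewrite subr_gt0.
  have [S [/= h1 h2]] := filter_ex (filterI FT (app_cvg x _ d0)).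
  have : d < (d - e * `|x|) + e * `|x|.
    apply: le_lt_trans (ler_distD (S x) _ _) _; apply: ltr_leD => //.
    rewrite distrC -[T x - S x]/((T - S) x); apply: le_trans (bop_norm_ler _ _) _.
    by rewrite ler_wpM2r // ltW.
  by rewrite subrK ltxx.
have fc : continuous f.
  have [T FT] := Fe 1 ltr01; have [k k0 hk] := bop_bounded T.
  apply: (@bounded_linear_bop f (1 + k)) => // x.
  rewrite -[f x](subrK (T x)); apply: le_trans (ler_normD _ _) _.
  by rewrite rmorphD mulrDl; apply: lerD; [exact: key|exact: hk].
pose g := Bop fl fc; apply/cvg_ex; exists g.
apply/cvgrPdist_lt => e e0.
have e2 : 0 < e / 4 by rewrite divr_gt0.
have [T FT] := Fe _ e2; apply: filterS (FT) => S /= TS.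
have gT : `|g - T| <= e / 4.
  apply: bop_norm_le; first exact: ltW.
  by move=> x; rewrite bop_addE bop_oppE; exact: key.
rewrite -[g - S](subrKA T); apply: le_lt_trans (ler_normD _ _) _.
apply: (@le_lt_trans _ _ (e / 4 + e / 4)); first by rewrite lerD // ltW.
have -> : e / 4 + e / 4 = e / 2 by field.
by rewrite ltr_pdivrMr // ltr_pMr // ltr1n.
Qed.

HB.instance Definition _ := Uniform_isComplete.Build (bop H) bop_complete.

Lemma adjoint_exists T :
  exists S : bop H, forall x y, inner (T x) y = inner x (S y).
Proof.
have [k k0 hk] := bop_bounded T.
have ex y : exists z, forall x, inner (T x) y = inner x z.
  apply: (@riesz_representation _ _ (fun x => inner (T x) y) (k * n y)).
  - by move=> x x'; rewrite bopD innerDl.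
  - by move=> c x; rewrite bopZ innerZl.
  - move=> x; apply: le_trans (cauchy_schwarz _ _) _.
    by rewrite rmorphM /= -nE mulrAC ler_wpM2r.
have [f ff] := choice ex.
have fl : linear f.
  move=> c x y; apply: inner_ext => z.
  by rewrite innerDr innerZr -!ff innerDr innerZr.
have fk x : `|f x| <= k%:C * `|x|.
  have [->|f0] := eqVneq (f x) 0; first by rewrite normr0 mulr_ge0 // lecR.
  have nf0 : 0 < `|f x| by rewrite normr_gt0.
  rewrite -(ler_pM2r nf0) -expr2 -inner_norm -ff.
  have := cauchy_schwarz (T (f x)) x; rewrite ff inner_norm ger0_norm ?exprn_ge0 //.
  move/le_trans; apply; rewrite mulrAC ler_wpM2r //; exact: hk.
by exists (Bop fl (bounded_linear_bop fl fk)).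
Qed.

Definition adjoint T : bop H := projT1 (cid (adjoint_exists T)).

Lemma adjointP T x y : inner (T x) y = inner x (adjoint T y).
Proof. by rewrite /adjoint; case: cid. Qed.

Lemma adjointPl T x y : inner (adjoint T x) y = inner x (T y).
Proof. by rewrite innerC -adjointP -innerC. Qed.

Fact bop_compA : associative (@bop_comp _ H).
Proof. by move=> S T U; apply: bopP. Qed.
Fact bop_compDl : left_distributive (@bop_comp _ H) +%R.
Proof. by move=> S T U; apply: bopP. Qed.
Fact bop_compDr : right_distributive (@bop_comp _ H) +%R.
Proof. by move=> S T U; apply: bopP => x /=; rewrite bopD. Qed.
Fact bop_compZl (c : R[i]) S T : bop_comp (c *: S) T = c *: bop_comp S T.
Proof. exact: bopP. Qed.
Fact bop_compZr (c : R[i]) S T : bop_comp S (c *: T) = c *: bop_comp S T.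
Proof. by apply: bopP => x /=; rewrite bopZ. Qed.
Fact adjointK : involutive adjoint.
Proof.
move=> T; apply: bopP => x; apply: inner_ext => y.
by rewrite -adjointP adjointPl.
Qed.
Fact adjointD : {morph adjoint : S T / S + T}.
Proof.
move=> S T; apply: bopP => x; apply: inner_ext => y.
by rewrite -adjointP !bop_addE innerDl innerDr !adjointP.
Qed.
Fact adjointZ (c : R[i]) T : adjoint (c *: T) = Num.conj c *: adjoint T.
Proof.
apply: bopP => x; apply: inner_ext => y.
by rewrite -adjointP !bop_scaleE innerZl innerZr conjCK adjointP.
Qed.
Fact adjointM S T : adjoint (bop_comp S T) = bop_comp (adjoint T) (adjoint S).
Proof.
apply: bopP => x; apply: inner_ext => y.
by rewrite -adjointP /= !adjointP.
Qed.

HB.instance Definition _ := Lmodule_isStarAlg.Build R[i] (bop H)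
  bop_compA bop_compDl bop_compDr bop_compZl bop_compZr
  adjointK adjointD adjointZ adjointM.

Fact bop_comp1l : left_id (@bop_id _ H) smul. Proof. by move=> T; apply: bopP. Qed.
Fact bop_comp1r : right_id (@bop_id _ H) smul. Proof. by move=> T; apply: bopP. Qed.

HB.instance Definition _ := StarAlg_isUnital.Build R[i] (bop H)
  bop_comp1l bop_comp1r.

Fact bop_normM S T : `|S ** T| <= `|S| * `|T|.
Proof.
apply: bop_norm_le => [|x]; first by rewrite mulr_ge0.
apply: le_trans (bop_norm_ler S (T x)) _.
by rewrite -mulrA ler_wpM2l // bop_norm_ler.
Qed.

Let bop_norm_sq T : `|T| ^+ 2 <= `|star T ** T|.
Proof.
set s := `|star T ** T|; have s0 : 0 <= s by exact: normr_ge0.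
rewrite -[s]sqrtCK ler_pXn2r ?nnegrE ?sqrtC_ge0 //.
apply: bop_norm_le => [|x]; first by rewrite sqrtC_ge0.
rewrite -(@ler_pXn2r _ 2) ?nnegrE ?mulr_ge0 ?sqrtC_ge0 //.
rewrite exprMn sqrtCK -inner_norm adjointP.
have := cauchy_schwarz x ((star T ** T) x); rewrite [X in `|X|](_ : _ = `|T x| ^+ 2); last first.
  by rewrite -inner_norm adjointP.
rewrite ger0_norm ?exprn_ge0 // -[inner _ _]/(inner x ((star T ** T) x)) -adjointP inner_norm.
move/le_trans; apply; rewrite mulrC expr2 mulrA ler_wpM2r //.
exact: bop_norm_ler.
Qed.

Let adjoint_norm_le T : `|T| <= `|star T|.
Proof.
have [->|T0] := eqVneq T 0; first by rewrite normr0.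
have nT : 0 < `|T| by rewrite normr_gt0.
by rewrite -(ler_pM2r nT) -expr2; apply: le_trans (bop_norm_sq T) (bop_normM _ _).
Qed.

Fact bop_cstar T : `|star T ** T| = `|T| ^+ 2.
Proof.
apply/le_anti/andP; split; last exact: bop_norm_sq.
apply: le_trans (bop_normM _ _) _; rewrite expr2 ler_wpM2r //.
by have := adjoint_norm_le (star T); rewrite starK.
Qed.

HB.instance Definition _ := StarAlg_isCStar.Build R[i] (bop H) bop_normM bop_cstar.

End BopCStar.

(* A finite quantum space, given by the block sizes of a decomposition of its
   algebra into a direct sum of full matrix algebras. *)
Record finqspace := FinQSpace {
  nblk : nat;
  bdim : 'I_nblk -> nat;
  bdim_gt0 : forall l, (0 < bdim l)%N
}.

(* [tens P A] is C(P) (x) A, i.e. the direct sum over [l] of the Mat_{m_l}(A):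
   [x l s t] is the coefficient in [A] of the matrix unit f^l_{st}. As C(P) is
   finite-dimensional the algebraic tensor product is already complete. *)
Definition tens (P : finqspace) (A : Type) : Type :=
  forall l : 'I_(nblk P), 'M[A]_(bdim l).

Section Tens.
Context {C : numClosedFieldType} {P : finqspace}.

Lemma tensP (A : Type) (x y : tens P A) :
  (forall l s t, x l s t = y l s t) -> x = y.
Proof. by move=> h; apply: functional_extensionality_dep => l; apply/matrixP. Qed.

HB.instance Definition _ (A : Type) := gen_eqMixin (tens P A).
HB.instance Definition _ (A : Type) := gen_choiceMixin (tens P A).

Section Zmod.
Context {A : zmodType}.

Definition tens_zero : tens P A := fun l => 0.
Definition tens_opp (x : tens P A) : tens P A := fun l => - x l.
Definition tens_add (x y : tens P A) : tens P A := fun l => x l + y l.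

Fact tens_addA : associative tens_add.
Proof. by move=> x y z; apply: tensP => l s t; rewrite !mxE addrA. Qed.
Fact tens_addC : commutative tens_add.
Proof. by move=> x y; apply: tensP => l s t; rewrite !mxE addrC. Qed.
Fact tens_add0 : left_id tens_zero tens_add.
Proof. by move=> x; apply: tensP => l s t; rewrite !mxE add0r. Qed.
Fact tens_addN : left_inverse tens_zero tens_opp tens_add.
Proof. by move=> x; apply: tensP => l s t; rewrite !mxE addNr. Qed.

HB.instance Definition _ :=
  GRing.isZmodule.Build (tens P A) tens_addA tens_addC tens_add0 tens_addN.

Lemma tens_addE (x y : tens P A) l s t : (x + y) l s t = x l s t + y l s t.
Proof. exact: mxE. Qed.

Lemma tens_zeroE l s t : (0 : tens P A) l s t = 0.
Proof. exact: mxE. Qed.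

Lemma tens_sumE I (r : seq I) (Q : pred I) (F : I -> tens P A) l s t :
  (\sum_(i <- r | Q i) F i) l s t = \sum_(i <- r | Q i) F i l s t.
Proof.
by apply: (big_morph (fun x : tens P A => x l s t)) => [x y|];
  rewrite ?tens_addE ?tens_zeroE.
Qed.

End Zmod.

Section Lmod.
Context {A : lmodType C}.

Definition tens_scale (c : C) (x : tens P A) : tens P A :=
  fun l => map_mx ( *:%R c) (x l).

Fact tens_scaleA a b x : tens_scale a (tens_scale b x) = tens_scale (a * b) x.
Proof. by apply: tensP => l s t; rewrite !mxE scalerA. Qed.
Fact tens_scale1 : left_id 1 tens_scale.
Proof. by move=> x; apply: tensP => l s t; rewrite !mxE scale1r. Qed.
Fact tens_scaleDr : right_distributive tens_scale +%R.
Proof. by move=> c x y; apply: tensP => l s t; rewrite !mxE scalerDr. Qed.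
Fact tens_scaleDl x : {morph tens_scale^~ x : a b / a + b}.
Proof. by move=> a b; apply: tensP => l s t; rewrite !mxE scalerDl. Qed.

HB.instance Definition _ := GRing.Zmodule_isLmodule.Build C (tens P A)
  tens_scaleA tens_scale1 tens_scaleDr tens_scaleDl.

Lemma tens_scaleE c (x : tens P A) l s t : (c *: x) l s t = c *: x l s t.
Proof. exact: mxE. Qed.

End Lmod.

Section StarAlgTheory.
Context {A : starAlgType C}.
Implicit Types (a b : A).

Lemma smul0l a : 0 ** a = 0 :> A.
Proof. by apply: (addrI (0 ** a)); rewrite -smulDl !addr0. Qed.
Lemma smul0r a : a ** 0 = 0 :> A.
Proof. by apply: (addrI (a ** 0)); rewrite -smulDr !addr0. Qed.
Lemma star0 : star 0 = 0 :> A.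
Proof. by apply: (addrI (star 0)); rewrite -starD !addr0. Qed.

Lemma smul_suml I (r : seq I) (Q : pred I) (F : I -> A) a :
  (\sum_(i <- r | Q i) F i) ** a = \sum_(i <- r | Q i) F i ** a.
Proof.
by apply: (big_morph (fun x => x ** a)) => [x y|]; rewrite ?smulDl ?smul0l.
Qed.

Lemma smul_sumr I (r : seq I) (Q : pred I) (F : I -> A) a :
  a ** (\sum_(i <- r | Q i) F i) = \sum_(i <- r | Q i) a ** F i.
Proof.
by apply: (big_morph (fun x => a ** x)) => [x y|]; rewrite ?smulDr ?smul0r.
Qed.

Lemma star_sum I (r : seq I) (Q : pred I) (F : I -> A) :
  star (\sum_(i <- r | Q i) F i) = \sum_(i <- r | Q i) star (F i).
Proof. by apply: (big_morph (@star C A)) => [x y|]; rewrite ?starD ?star0. Qed.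

End StarAlgTheory.

Section TensStarAlg.
Context {A : starAlgType C}.

Definition tens_mul (x y : tens P A) : tens P A :=
  fun l => \matrix_(s, t) \sum_r x l s r ** y l r t.
Definition tens_star (x : tens P A) : tens P A :=
  fun l => \matrix_(s, t) star (x l t s).

Fact tens_mulA : associative tens_mul.
Proof.
move=> x y z; apply: tensP => l s t; rewrite !mxE.
under eq_bigr do rewrite mxE smul_sumr.
rewrite exchange_big /=; apply: eq_bigr => r _; rewrite mxE smul_suml.
by apply: eq_bigr => q _; rewrite smulA.
Qed.
Fact tens_mulDl : left_distributive tens_mul +%R.
Proof.
move=> x y z; apply: tensP => l s t; rewrite !mxE -big_split /=.
by apply: eq_bigr => r _; rewrite mxE smulDl.
Qed.
Fact tens_mulDr : right_distributive tens_mul +%R.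
Proof.
move=> x y z; apply: tensP => l s t; rewrite !mxE -big_split /=.
by apply: eq_bigr => r _; rewrite mxE smulDr.
Qed.
Fact tens_mulZl (c : C) x y : tens_mul (c *: x) y = c *: tens_mul x y.
Proof.
apply: tensP => l s t; rewrite !mxE scaler_sumr.
by apply: eq_bigr => r _; rewrite mxE smulZl.
Qed.
Fact tens_mulZr (c : C) x y : tens_mul x (c *: y) = c *: tens_mul x y.
Proof.
apply: tensP => l s t; rewrite !mxE scaler_sumr.
by apply: eq_bigr => r _; rewrite mxE smulZr.
Qed.
Fact tens_starK : involutive tens_star.
Proof. by move=> x; apply: tensP => l s t; rewrite !mxE starK. Qed.
Fact tens_starD : {morph tens_star : x y / x + y}.
Proof. by move=> x y; apply: tensP => l s t; rewrite !mxE starD. Qed.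
Fact tens_starZ (c : C) x : tens_star (c *: x) = c^* *: tens_star x.
Proof. by apply: tensP => l s t; rewrite !mxE starZ. Qed.
Fact tens_starM x y : tens_star (tens_mul x y) = tens_mul (tens_star y) (tens_star x).
Proof.
apply: tensP => l s t; rewrite !mxE star_sum.
by apply: eq_bigr => r _; rewrite !mxE starM.
Qed.

HB.instance Definition _ := Lmodule_isStarAlg.Build C (tens P A)
  tens_mulA tens_mulDl tens_mulDr tens_mulZl tens_mulZr
  tens_starK tens_starD tens_starZ tens_starM.

Lemma tens_mulE (x y : tens P A) l s t :
  (x ** y) l s t = \sum_r x l s r ** y l r t.
Proof. exact: mxE. Qed.

Lemma tens_starE (x : tens P A) l s t : (star x) l s t = star (x l t s).
Proof. exact: mxE. Qed.

End TensStarAlg.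

Section TensUnital.
Context {A : ustarAlgType C}.

Definition tens_one : tens P A :=
  fun l => \matrix_(s, t) if s == t then sone else 0.

Fact tens_mul1l : left_id tens_one smul.
Proof.
move=> x; apply: tensP => l s t; rewrite tens_mulE (bigD1 s) //= mxE eqxx smul1l.
rewrite big1 ?addr0 // => r rs; rewrite mxE eq_sym (negbTE rs); exact: smul0l.
Qed.
Fact tens_mul1r : right_id tens_one smul.
Proof.
move=> x; apply: tensP => l s t; rewrite tens_mulE (bigD1 t) //= mxE eqxx smul1r.
rewrite big1 ?addr0 // => r rs; rewrite mxE (negbTE rs); exact: smul0r.
Qed.

HB.instance Definition _ :=
  StarAlg_isUnital.Build C (tens P A) tens_mul1l tens_mul1r.

Lemma tens_oneE l s t : (sone : tens P A) l s t = if s == t then sone else 0.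
Proof. exact: mxE. Qed.

End TensUnital.

(* All norms making [tens P A] a C*-algebra induce the entrywise topology. *)
HB.instance Definition _ (A : topologicalType) := Topological.copy (tens P A)
  (prod_topology (fun l : 'I_(nblk P) => 'M[A]_(bdim l))).

HB.instance Definition _ (A : topStarAlgType C) := Topological.on (tens P A).

End Tens.

Section Scalars.
Context {C : numClosedFieldType}.

Fact scal_mulDl : left_distributive ( *%R : C^o -> C^o -> C^o) +%R.
Proof. exact: mulrDl. Qed.
Fact scal_mulDr : right_distributive ( *%R : C^o -> C^o -> C^o) +%R.
Proof. exact: mulrDr. Qed.
Fact scal_mulZl (c : C) (a b : C^o) : (c *: a) * b = c *: (a * b) :> C^o.
Proof. exact/esym/mulrA. Qed.
Fact scal_mulZr (c : C) (a b : C^o) : a * (c *: b) = c *: (a * b) :> C^o.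
Proof. exact: mulrCA. Qed.
Fact scal_starD : {morph (Num.conj : C^o -> C^o) : a b / a + b}.
Proof. exact: rmorphD. Qed.
Fact scal_starZ (c : C) (a : C^o) : Num.conj (c *: a) = c^* *: Num.conj a :> C^o.
Proof. exact: rmorphM. Qed.
Fact scal_starM (a b : C^o) : Num.conj (a * b) = Num.conj b * Num.conj a :> C^o.
Proof. by rewrite mulrC rmorphM. Qed.

HB.instance Definition _ := Lmodule_isStarAlg.Build C C^o
  (@mulrA C) scal_mulDl scal_mulDr scal_mulZl scal_mulZr
  (@conjCK C) scal_starD scal_starZ scal_starM.

HB.instance Definition _ := StarAlg_isUnital.Build C C^o (@mul1r C) (@mulr1 C).

End Scalars.

(* C(P) *)
Notation falg C P := (tens P C^o).

Section TensorCalculus.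
Context {C : numClosedFieldType}.

(* The matrix unit f^l_{st} of C(P). *)
Definition munit {P : finqspace} (l : 'I_(nblk P)) (s t : 'I_(bdim l)) :
    falg C P :=
  fun l' => \matrix_(i, j)
    ([&& l' == l, val i == val s & val j == val t])%:R.

(* The simple tensor x (x) a. *)
Definition tensor {P : finqspace} {A : lmodType C} (x : falg C P) (a : A) :
    tens P A :=
  fun l => \matrix_(s, t) ((x l s t : C) *: a).

(* id (x) f *)
Definition tmap {P : finqspace} {A B : Type} (f : A -> B) (x : tens P A) :
    tens P B :=
  fun l => map_mx f (x l).

Definition leg13 {P : finqspace} {A : ustarAlgType C} (z : tens P A) :
    tens P (tens P A) :=
  tmap (tensor sone) z.

Definition leg23 {P : finqspace} {A : ustarAlgType C} (z : tens P A) :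
    tens P (tens P A) :=
  tensor sone z.

Lemma tens_munit {P : finqspace} {A : lmodType C} (x : tens P A) :
  x = \sum_l \sum_s \sum_t tensor (munit s t) (x l s t).
Proof.
apply: tensP => l s t; rewrite tens_sumE (bigD1 l) //= [X in _ + X]big1 => [|l' ll'].
  rewrite addr0 tens_sumE (bigD1 s) //= [X in _ + X]big1 => [|s' ss'].
    rewrite addr0 tens_sumE (bigD1 t) //= [X in _ + X]big1 => [|t' tt'].
      by rewrite addr0 !mxE !eqxx scale1r.
    by rewrite !mxE !(inj_eq val_inj) [t == _]eq_sym (negbTE tt') !andbF scale0r.
  rewrite tens_sumE big1 // => t' _.
  by rewrite !mxE !(inj_eq val_inj) [s == _]eq_sym (negbTE ss') !andbF scale0r.
rewrite tens_sumE big1 // => s' _; rewrite tens_sumE big1 // => t' _.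
by rewrite !mxE eq_sym (negbTE ll') scale0r.
Qed.

End TensorCalculus.

Section Morphisms.
Context {C : numClosedFieldType}.

Definition is_starhom {A B : starAlgType C} (f : A -> B) : Prop :=
  [/\ linear f, {morph f : a b / a ** b} & {morph f : a / star a}].

Definition is_ustarhom {A B : ustarAlgType C} (f : A -> B) : Prop :=
  is_starhom f /\ f sone = sone.

(* [mor pi] says that [pi] is an element of Mor(A, B), a non-degenerate
   *-homomorphism from A to the multiplier algebra M(B). A multiplier of B is
   identified with its left action on B: M(B) is the *-algebra of the maps
   m : B -> B having an adjoint m' in the sense that (m b)^* c = b^* (m' c) for
   all b, c (such maps are automatically linear and bounded), the involution
   exchanging m and m'. Thus [pi a b] is the product of the multiplier pi(a) by
   b, and the third clause says both that pi(a) is in M(B) and that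
   pi(a)^* = pi(a^* ). *)
Definition mor {A : starAlgType C} {B : topStarAlgType C} (pi : A -> B -> B) :
    Prop :=
  [/\ forall c a1 a2 b, pi (c *: a1 + a2) b = c *: pi a1 b + pi a2 b,
      forall a1 a2 b, pi (a1 ** a2) b = pi a1 (pi a2 b),
      forall a b1 b2, star (pi a b1) ** b2 = star b1 ** pi (star a) b2 &
      closure [set y | exists n (a : 'I_n -> A) (b : 'I_n -> B),
                         y = \sum_i pi (a i) (b i)] = setT].

(* For Lam in Mor(A, B), the action on C(P) (x) B of the multipliers
   (id (x) Lam)(z). *)
Definition tact {P : finqspace} {A B : starAlgType C} (Lam : A -> B -> B)
    (z : tens P A) (b : tens P B) : tens P B :=
  fun l => \matrix_(s, t) \sum_r Lam (z l s r) (b l r t).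

(* (C(M), Phi) is the pair (C(M_{P,O}), Phi_{P,O}): the universal quantum
   family of maps from P to O. *)
Definition is_quantum_maps (P O : finqspace) (M : ucstarAlgType C)
    (Phi : falg C O -> tens P M) : Prop :=
  is_ustarhom Phi /\
  forall (X : cstarAlgType C) (Psi : falg C O -> tens P X -> tens P X),
    mor Psi ->
    exists! Lam : M -> X -> X, mor Lam /\ forall x, Psi x = tact Lam (Phi x).

(* The coefficients V^{l,st}_{k,ij} of a map C(O) -> C(P) (x) A. *)
Definition coef {P O : finqspace} {A : Type} (Phi : falg C O -> tens P A)
    (l : 'I_(nblk P)) (s t : 'I_(bdim l))
    (k : 'I_(nblk O)) (i j : 'I_(bdim k)) : A :=
  Phi (munit i j) l s t.

Lemma coef_sum {P O : finqspace} {A : lmodType C} (Phi : falg C O -> tens P A)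
    (k : 'I_(nblk O)) (i j : 'I_(bdim k)) :
  Phi (munit i j) =
    \sum_l \sum_s \sum_t tensor (munit s t) (coef Phi (l := l) s t i j).
Proof. exact: tens_munit. Qed.

End Morphisms.

Section States.
Context {C : numClosedFieldType}.

Definition is_state {A : ustarAlgType C} (w : A -> C) : Prop :=
  [/\ linear (w : A -> C^o), forall a, 0 <= w (star a ** a) & w sone = 1].

Definition trace_on {A : starAlgType C} (D : set A) (w : A -> C) : Prop :=
  [/\ forall c a b, D a -> D b -> w (c *: a + b) = c * w a + w b,
      forall a, D a -> 0 <= w (star a ** a) &
      forall a b, D a -> D b -> w (a ** b) = w (b ** a)].

Definition closed_star_subalg {A : topStarAlgType C} (D : set A) : Prop :=
  [/\ D 0, forall c a b, D a -> D b -> D (c *: a + b),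
      forall a b, D a -> D b -> D (a ** b), forall a, D a -> D (star a) &
      closed D].

Definition cstar_generated {A : topStarAlgType C} (S : set A) : set A :=
  smallest closed_star_subalg S.

Definition vector_state {H : hilbertType C} (xi : H) (a : bop H) : C :=
  inner (a xi) xi.

End States.

Section Correlations.
Context {C : numClosedFieldType}.

Definition spos {A : starAlgType C} (x : A) : Prop := exists y, x = star y ** y.

Definition mat_qspace (n : nat) : finqspace :=
  @FinQSpace 1 (fun=> n.+1) (fun=> ltn0Sn n).

Definition completely_positive {A B : starAlgType C} (f : A -> B) : Prop :=
  forall n (x : tens (mat_qspace n) A), spos x -> spos (tmap f x).

Section Coefficients.
Context {P O : finqspace}.
(* C(O) (x) C(O) -> C(P) (x) C(P) *)
Implicit Type T : tens O (falg C O) -> tens P (falg C P).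

Definition is_correlation T : Prop :=
  [/\ linear T, completely_positive T & T sone = sone].

Definition corr_coef T
    (l : 'I_(nblk P)) (s t : 'I_(bdim l))
    (l' : 'I_(nblk P)) (s' t' : 'I_(bdim l'))
    (k : 'I_(nblk O)) (i j : 'I_(bdim k))
    (k' : 'I_(nblk O)) (i' j' : 'I_(bdim k')) : C :=
  T (tensor (munit i j) (munit i' j')) l s t l' s' t'.

Definition synchronous T : Prop :=
  \sum_(k < nblk O) \sum_(l < nblk P) \sum_(i < bdim k) \sum_(j < bdim k)
    \sum_(s < bdim l) \sum_(t < bdim l)
      ((bdim k)%:R * (bdim l)%:R)^-1 * corr_coef T s t s t i j i j
  = (nblk P)%:R.

(* T_tau, extended linearly from the simple tensors e^k_{ij} (x) e^{k'}_{i'j'}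
   (see [corr_of_munit]). *)
Definition corr_of {M : starAlgType C} (Phi : falg C O -> tens P M)
    (tau : M -> C) (z : tens O (falg C O)) : tens P (falg C P) :=
  \sum_k \sum_i \sum_j \sum_k' \sum_i' \sum_j' (z k i j k' i' j' : C) *:
    \sum_l \sum_s \sum_t \sum_l' \sum_s' \sum_t'
      tau (coef Phi (l := l) s t (k := k) i j **
           coef Phi (l := l') t' s' (k := k') j' i')
        *: tensor (munit s t) (munit s' t').

End Coefficients.

Lemma munitE (P : finqspace) (l : 'I_(nblk P)) (i j s t : 'I_(bdim l)) :
  (munit i j : falg C P) l s t = ((s == i) && (t == j))%:R.
Proof. by rewrite mxE eqxx !(inj_eq val_inj). Qed.

Lemma munit_neq (P : finqspace) (l l' : 'I_(nblk P)) (i j : 'I_(bdim l))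
  (s t : 'I_(bdim l')) : l' != l -> (munit i j : falg C P) l' s t = 0.
Proof. by move=> h; rewrite mxE (negbTE h). Qed.

Let sum_munit (P : finqspace) (V : lmodType C) (k : 'I_(nblk P)) (i j : 'I_(bdim k))
    (F : forall l, 'I_(bdim l) -> 'I_(bdim l) -> V) :
  \sum_l \sum_s \sum_t ((munit i j : falg C P) l s t : C) *: F l s t = F k i j.
Proof.
rewrite (bigD1 k) //= [X in _ + X]big1 ?addr0 => [|l lk]; last first.
  by rewrite big1 // => s _; rewrite big1 // => t _; rewrite munit_neq // scale0r.
rewrite (bigD1 i) //= [X in _ + X]big1 ?addr0 => [|s si]; last first.
  by rewrite big1 // => t _; rewrite munitE (negbTE si) scale0r.
rewrite (bigD1 j) //= [X in _ + X]big1 ?addr0 => [|t tj]; last first.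
  by rewrite munitE (negbTE tj) andbF scale0r.
by rewrite munitE !eqxx scale1r.
Qed.

Lemma corr_of_munit {P O : finqspace} {M : starAlgType C}
    (Phi : falg C O -> tens P M) (tau : M -> C)
    (k : 'I_(nblk O)) (i j : 'I_(bdim k))
    (k' : 'I_(nblk O)) (i' j' : 'I_(bdim k')) :
  corr_of Phi tau (tensor (munit i j) (munit i' j')) =
    \sum_l \sum_s \sum_t \sum_l' \sum_s' \sum_t'
      tau (coef Phi (l := l) s t i j ** coef Phi (l := l') t' s' j' i')
        *: tensor (munit s t) (munit s' t').
Proof.
rewrite /corr_of.
under eq_bigr => q _ do under eq_bigr => a _ do under eq_bigr => b _ do
  under eq_bigr => q' _ do under eq_bigr => a' _ do under eq_bigr => b' _ do
    rewrite mxE tens_scaleE -scalerA.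
under eq_bigr => q _ do under eq_bigr => a _ do under eq_bigr => b _ do
  (under eq_bigr => q' _ do (under eq_bigr => a' _ do
    rewrite -scaler_sumr; rewrite -scaler_sumr); rewrite -scaler_sumr sum_munit).
exact: sum_munit.
Qed.

End Correlations.

Section Realizations.
Context {R : realType} {P O : finqspace} {H : hilbertType R[i]}.

Definition second_leg_commute (Phi1 Phi2 : falg R[i] O -> tens P (bop H)) :
    Prop :=
  forall x y : falg R[i] O,
    leg13 (Phi1 x) ** leg23 (Phi2 y) = leg23 (Phi2 y) ** leg13 (Phi1 x).

Definition is_realization (T : tens O (falg R[i] O) -> tens P (falg R[i] P))
    (Phi1 Phi2 : falg R[i] O -> tens P (bop H)) (xi : H) : Prop :=
  [/\ is_ustarhom Phi1, is_ustarhom Phi2, second_leg_commute Phi1 Phi2,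
      `|xi| = 1 &
      forall x y : falg R[i] O,
        T (tensor x y) =
          tmap (tmap (vector_state xi)) (leg13 (Phi1 x) ** leg23 (Phi2 y))].

End Realizations.

(* Main.v *)
(* Synchronicity is the equality case of Cauchy-Schwarz: for the weights
   1 / (n_k m_l), the families [W xi] and [U^* xi] have squared norm [N_P]
   because [Phi1] and [Phi2] are unital *-homomorphisms, and their inner product
   is also [N_P], so [W xi = U^* xi].  As the [U]'s commute with the [W]'s, this
   yields [omega (a u) = omega (u a)] for [a] commuting with the [W]'s; the
   operators with this property that commute with the [W]'s form a closed unital
   *-subalgebra [B] containing the [U]'s.  Applying the universal property to [B]
   itself, and its uniqueness part to [B(H)], shows that [Lam1] takes its values
   in [B], whence the trace property on the whole of C(M_{P,O}). *)
Require Import Defs.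
From HB Require Import structures.
From mathcomp Require Import all_boot all_order all_algebra complex.
From mathcomp Require Import boolp classical_sets reals topology normedtype.

Import Order.TTheory GRing.Theory Num.Theory.
Import numFieldNormedType.Exports.

Local Open Scope classical_set_scope.
Local Open Scope ring_scope.
Local Open Scope complex_scope.

(** If [f x] were nonzero at a point [x] of the closure, a zero [y] of [f] within [|f x| / k] of [x]
    would give [|f x| = |f (x - y)| < |f x|]. The form with bare functions fits commutator
    expressions directly. *)
Lemma closed_ker {C : numFieldType} {V W : normedModType C} (f : V -> W) (k : C) :
  (forall x y, f (x - y) = f x - f y) -> (forall x, `|f x| <= k * `|x|) ->
  closed [set x | f x = 0].
Proof.
move=> fB fk x xcl; apply/eqP; rewrite -normr_le0 /=.
apply/negPn/negP => fx0.
have fx : 0 < `|f x| by rewrite lt_neqAle normr_ge0 andbT; apply: contra fx0 => /eqP <-.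
have k0 : 0 < k.
  rewrite lt_neqAle eq_sym; apply/andP; split.
    by apply: contraL fx => /eqP k0; have := fk x; rewrite k0 mul0r => /le_gtF ->.
  have x0 : 0 < `|x|.
    rewrite normr_gt0; apply: contraL fx => /eqP ->.
    by have := fB 0 0; rewrite !subrr => ->; rewrite normr0 ltxx.
  by rewrite -(pmulr_lge0 _ x0); apply: le_trans (fk x).
have [y [/= fy]] := xcl _ (nbhsx_ballx x _ (divr_gt0 fx k0)).
rewrite -ball_normE /ball_ /= ltr_pdivlMr // mulrC => /(le_lt_trans (fk _)).
by rewrite fB fy subr0 ltxx.
Qed.

(** * Closed unital star-subalgebras as C*-algebras *)

Section Subalgebra.
Context {C : numClosedFieldType} {A : ucstarAlgType C}.

Record ucsubalg := UCSubalg {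
  ucs_set : set A;
  ucs_closed : closed_star_subalg ucs_set;
  ucs_one : ucs_set sone
}.

Definition ucs_pred (B : ucsubalg) : {pred A} := fun x => `[< ucs_set B x >].

Fact ucs_submod B : submod_closed (ucs_pred B).
Proof.
have [B0 Blin _ _ _] := ucs_closed B.
split; first exact/asboolP.
by move=> c x y /asboolP Bx /asboolP By; apply/asboolP/Blin.
Qed.

HB.instance Definition _ B := GRing.isSubmodClosed.Build C A (ucs_pred B) (ucs_submod B).

(** The universal property quantifies over types carrying a C*-structure, not over subsets, so the
    subalgebra is turned into a type that can serve as its target. *)
Definition ucs_sort (B : ucsubalg) : Type := {x : A | ucs_pred B x}.

Variable B : ucsubalg.

HB.instance Definition _ := SubType.on (ucs_sort B).
HB.instance Definition _ := Choice.on (ucs_sort B).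
HB.instance Definition _ := [SubChoice_isSubLmodule of (ucs_sort B) by <:].

Definition ucs_norm (x : ucs_sort B) : C := `|\val x|.
Fact ucs_normD x y : ucs_norm (x + y) <= ucs_norm x + ucs_norm y.
Proof. exact: ler_normD. Qed.
Fact ucs_normZ (c : C) x : ucs_norm (c *: x) = `|c| * ucs_norm x.
Proof. by rewrite /ucs_norm linearZ normrZ. Qed.
Fact ucs_norm0 x : ucs_norm x = 0 -> x = 0.
Proof. by move=> /normr0_eq0 x0; apply: val_inj; rewrite x0. Qed.

HB.instance Definition _ := Lmodule_isNormed.Build C (ucs_sort B)
  ucs_normD ucs_normZ ucs_norm0.

Lemma ucs_normE (x : ucs_sort B) : `|x| = `|\val x|. Proof. by []. Qed.

(** The image of a Cauchy filter converges in [A], and closedness of [ucs_set B] puts the limit back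
    into the subalgebra. *)
Fact ucs_complete (F : set_system (ucs_sort B)) : ProperFilter F -> cauchy F -> cvg F.
Proof.
move=> FF Fc; have [_ _ _ _ Bcl] := ucs_closed B.
have : cvg ((\val : ucs_sort B -> A) @ F).
  apply: cauchy_cvg; apply: cauchy_exP => e e0.
  have /cauchyP /(_ e e0) [x Fx] := Fc.
  exists (\val x).
  suff : F [set y | ball (\val x) e (\val y)] by [].
  by apply: filterS Fx => y; rewrite -!ball_normE.
move=> /cvg_ex [l Fl].
have Bl : ucs_set B l.
  by apply: (closed_cvg _ Bcl _ _ Fl); apply: nearW => x; exact/asboolP/(valP x).
have lP : ucs_pred B l by apply/asboolP.
apply/cvg_ex; exists (Sub l lP : ucs_sort B).
apply/cvgrPdist_lt => e e0.
by move/cvgrPdist_lt : Fl => /(_ e e0); apply: filterS => y /=; rewrite ucs_normE raddfB.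
Qed.

HB.instance Definition _ := Uniform_isComplete.Build (ucs_sort B) ucs_complete.

Fact ucs_valP (x : ucs_sort B) : ucs_set B (\val x). Proof. exact/asboolP/(valP x). Qed.

Fact ucs_mulP (x y : ucs_sort B) : ucs_pred B (\val x ** \val y).
Proof. by have [_ _ h _ _] := ucs_closed B; apply/asboolP/h; exact: ucs_valP. Qed.
Fact ucs_starP (x : ucs_sort B) : ucs_pred B (star (\val x)).
Proof. by have [_ _ _ h _] := ucs_closed B; apply/asboolP/h; exact: ucs_valP. Qed.
Fact ucs_oneP : ucs_pred B sone.
Proof. exact/asboolP/ucs_one. Qed.

Definition ucs_mul (x y : ucs_sort B) : ucs_sort B := Sub _ (ucs_mulP x y).
Definition ucs_star (x : ucs_sort B) : ucs_sort B := Sub _ (ucs_starP x).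
Definition ucs_sone : ucs_sort B := Sub _ ucs_oneP.

Fact ucs_mulA : associative ucs_mul.
Proof. by move=> x y z; apply: val_inj; exact: smulA. Qed.
Fact ucs_mulDl : left_distributive ucs_mul +%R.
Proof. by move=> x y z; apply: val_inj; exact: smulDl. Qed.
Fact ucs_mulDr : right_distributive ucs_mul +%R.
Proof. by move=> x y z; apply: val_inj; exact: smulDr. Qed.
Fact ucs_mulZl (c : C) x y : ucs_mul (c *: x) y = c *: ucs_mul x y.
Proof. by apply: val_inj; exact: smulZl. Qed.
Fact ucs_mulZr (c : C) x y : ucs_mul x (c *: y) = c *: ucs_mul x y.
Proof. by apply: val_inj; exact: smulZr. Qed.
Fact ucs_starK : involutive ucs_star.
Proof. by move=> x; apply: val_inj; exact: starK. Qed.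
Fact ucs_starD : {morph ucs_star : x y / x + y}.
Proof. by move=> x y; apply: val_inj; exact: starD. Qed.
Fact ucs_starZ (c : C) x : ucs_star (c *: x) = Num.conj c *: ucs_star x.
Proof. by apply: val_inj; exact: starZ. Qed.
Fact ucs_starM x y : ucs_star (ucs_mul x y) = ucs_mul (ucs_star y) (ucs_star x).
Proof. by apply: val_inj; exact: starM. Qed.

HB.instance Definition _ := Lmodule_isStarAlg.Build C (ucs_sort B)
  ucs_mulA ucs_mulDl ucs_mulDr ucs_mulZl ucs_mulZr
  ucs_starK ucs_starD ucs_starZ ucs_starM.

Fact ucs_mul1l : left_id ucs_sone smul.
Proof. by move=> x; apply: val_inj; exact: smul1l. Qed.
Fact ucs_mul1r : right_id ucs_sone smul.
Proof. by move=> x; apply: val_inj; exact: smul1r. Qed.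

HB.instance Definition _ := StarAlg_isUnital.Build C (ucs_sort B) ucs_mul1l ucs_mul1r.

Fact ucs_normM (x y : ucs_sort B) : `|x ** y| <= `|x| * `|y|.
Proof. by rewrite !ucs_normE SubK cstar_normM. Qed.
Fact ucs_cstar (x : ucs_sort B) : `|star x ** x| = `|x| ^+ 2.
Proof. by rewrite !ucs_normE !SubK cstar_norm. Qed.

HB.instance Definition _ := StarAlg_isCStar.Build C (ucs_sort B) ucs_normM ucs_cstar.

Lemma val_ustarhom : is_ustarhom (\val : ucs_sort B -> A).
Proof.
split=> //; by split=> //; exact: linearP.
Qed.


End Subalgebra.

(** * From multiplier-valued morphisms to unital star-homomorphisms *)

Section UniversalProperty.
Context {C : numClosedFieldType}.

Lemma smulBr {A : starAlgType C} (a x y : A) : a ** (x - y) = a ** x - a ** y.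
Proof. by rewrite smulDr -(scaleN1r y) smulZr scaleN1r. Qed.

Lemma smulBl {A : starAlgType C} (a x y : A) : (x - y) ** a = x ** a - y ** a.
Proof. by rewrite smulDl -(scaleN1r y) smulZl scaleN1r. Qed.

Lemma ustarhom_comp {A B D : ustarAlgType C} (g : B -> D) (f : A -> B) :
  is_ustarhom g -> is_ustarhom f -> is_ustarhom (g \o f).
Proof.
move=> [[gl gM gs] g1] [[fl fM fs] f1]; split; last by rewrite /= f1.
by split=> [c x y|x y|x] /=; rewrite ?fl ?gl ?fM ?gM ?fs ?gs.
Qed.

(** The unit is an explicit element [e], since [X] is only a [topStarAlgType]; this covers
    [tens P X] as well. Non-degeneracy holds because every [x] equals [L sone ** x]. *)
Lemma mor_smul {A : ustarAlgType C} {X : topStarAlgType C} {e : X} {L : A -> X} :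
  left_id e smul -> is_starhom L -> L sone = e -> mor (fun a b => L a ** b).
Proof.
move=> e1 [Ll LM Ls] L1; split.
- by move=> c a1 a2 b; rewrite Ll smulDl smulZl.
- by move=> a1 a2 b; rewrite LM smulA.
- by move=> a b1 b2; rewrite starM Ls smulA.
- apply/seteqP; split=> // x _; apply: subset_closure.
  by exists 1%N, (fun=> sone), (fun=> x); rewrite big_ord1 L1 e1.
Qed.

(* [p = Lam 1 1] is a left unit on the span of the [Lam a b], hence on its
   closure, which is everything by non-degeneracy. *)
Lemma mor_unital {A : ustarAlgType C} {X : ucstarAlgType C} {Lam : A -> X -> X} :
  mor Lam ->
  is_ustarhom (Lam^~ sone) /\ forall a b, Lam a b = Lam a sone ** b.
Proof.
move=> [Ll LM Ls Lnd].
have star1 : star sone = sone :> X by rewrite -[LHS]smul1r -[X in _ ** X]starK -starM smul1r starK.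
(* Taking [b1 = sone] in the adjoint clause turns the multiplier into left multiplication by an
   element of [X]. *)
have LE a b : Lam a b = star (Lam (star a) sone) ** b.
  by rewrite Ls star1 smul1l starK.
have Lst a : Lam (star a) sone = star (Lam a sone).
  by rewrite [Lam (star a) sone]LE starK smul1r.
have {}LE a b : Lam a b = Lam a sone ** b by rewrite LE Lst starK.
split=> //; split; last first.
  pose p := Lam sone sone.
  have cl : closed [set x : X | p ** x - x = 0].
    apply: (@closed_ker C X X _ (`|p| + 1)) => [x y|x].
      by rewrite smulBr !opprD !opprK addrACA.
    rewrite mulrDl mul1r; apply: le_trans (ler_normB _ _) _.
    by rewrite lerD2r cstar_normM.
  have : closure [set y | exists n (a : 'I_n -> A) (b : 'I_n -> X),
                         y = \sum_i Lam (a i) (b i)] sone by rewrite Lnd.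
  move=> h; suff : [set x : X | p ** x - x = 0] sone.
    by move=> /= /eqP; rewrite smul1r subr_eq0 => /eqP.
  apply: (cl); apply: closureS h => _ [n [a [b ->]]] /=.
  rewrite smul_sumr; apply/eqP; rewrite subr_eq0; apply/eqP/eq_bigr => i _.
  by rewrite /p -LE -LM smul1l.
split.
- by move=> c x y; rewrite Ll.
- by move=> x y; rewrite LM LE.
- by move=> x; rewrite Lst.
Qed.

(** For a unital target, [mor_smul] and [mor_unital] translate between unital star-homomorphisms and
    elements of Mor, so existence and uniqueness carry over. *)
Lemma quantum_maps_unital {P O : finqspace} {M : ucstarAlgType C}
    {Phi : falg C O -> tens P M} {X : ucstarAlgType C} {phi : falg C O -> tens P X} :
  is_quantum_maps Phi -> is_ustarhom phi ->
  exists! L : M -> X, is_ustarhom L /\ phi = tmap L \o Phi.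
Proof.
move=> [_ univ] hphi.
have [Lam [[Lmor LE] Luniq]] := univ X _ (mor_smul (smul1l (s := tens P X)) hphi.1 hphi.2).
have [Lhom L1] := mor_unital Lmor.
exists (Lam^~ sone); split; first split=> //.
  apply/funext => x.
  (* Evaluating both actions at the unit of [tens P X] recovers the elements from the multipliers
     they define. *)
  rewrite -[LHS]smul1r [LHS](congr1 (fun g => g (sone : tens P X)) (LE x)).
  apply: tensP => l s t; rewrite !mxE (bigD1 t) //= tens_oneE eqxx.
  rewrite big1 ?addr0 // => r rt; rewrite tens_oneE (negbTE rt) L1.
  exact: smul0r.
move=> L [hL hLE].
have -> : Lam = fun a b => L a ** b.
  apply: Luniq; split; first exact: mor_smul smul1l hL.1 hL.2.
  move=> x; apply/funext => b; apply: tensP => l s t.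
  rewrite hLE tens_mulE mxE; by apply: eq_bigr => r _; rewrite !mxE.
by apply/funext => a; rewrite smul1r.
Qed.

End UniversalProperty.

(** * Matrix units and the relations between coefficients *)

Section Coefficients.
Context {C : numClosedFieldType} {P O : finqspace}.

Lemma falg_sum (x : falg C O) :
  x = \sum_k \sum_i \sum_j (x k i j : C) *: munit i j.
Proof.
rewrite [LHS]tens_munit; apply: eq_bigr => k _; apply: eq_bigr => i _.
apply: eq_bigr => j _; apply: tensP => l s t; rewrite !mxE; exact: mulrC.
Qed.

Lemma linear_falg {V : lmodType C} (f : falg C O -> V) (x : falg C O) : linear f ->
  f x = \sum_k \sum_i \sum_j (x k i j : C) *: f (munit i j).
Proof.
move=> fl; pose g : {linear falg C O -> V} := HB.pack f (GRing.isLinear.Build _ _ _ _ f fl).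
rewrite [in LHS](falg_sum x) -[f]/(g : _ -> _) linear_sum; apply: eq_bigr => k _.
rewrite linear_sum; apply: eq_bigr => i _; rewrite linear_sum; apply: eq_bigr => j _.
by rewrite linearZ.
Qed.

Lemma munit_mul (k : 'I_(nblk O)) (i j j' : 'I_(bdim k)) :
  (munit i j : falg C O) ** munit j j' = munit i j'.
Proof.
apply: tensP => l; have [->|lk] := eqVneq l k => s t; rewrite tens_mulE; last first.
  rewrite [RHS]munit_neq // big1 // => r _.
  by rewrite [munit i j l s r]munit_neq //; exact: smul0l.
rewrite (bigD1 j) //= big1 => [|r rj]; last first.
  by rewrite munitE (negbTE rj) andbF; exact: smul0l.
rewrite addr0 !munitE eqxx andbT /=.
rewrite [LHS](_ : _ = (s == i)%:R * (t == j')%:R) //.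
by rewrite -natrM mulnb.
Qed.

Lemma munit_star (k : 'I_(nblk O)) (i j : 'I_(bdim k)) :
  star (munit i j : falg C O) = munit j i.
Proof.
apply: tensP => l; have [->|lk] := eqVneq l k => s t; rewrite tens_starE; last first.
  by rewrite [RHS]munit_neq // [X in star X]munit_neq // star0.
by rewrite !munitE andbC; exact: conjC_nat.
Qed.

Lemma munit_one : \sum_(k < nblk O) \sum_(i < bdim k) munit i i = sone :> falg C O.
Proof.
apply: tensP => l s t; rewrite tens_sumE (bigD1 l) //= [X in _ + X]big1 => [|k kl]; last first.
  by rewrite tens_sumE big1 // => i _; rewrite munit_neq // eq_sym.
rewrite addr0 tens_sumE (bigD1 s) //= [X in _ + X]big1 => [|i si]; last first.
  by rewrite munitE eq_sym (negbTE si).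
by rewrite addr0 munitE eqxx tens_oneE eq_sym; case: eqP.
Qed.

Context {A : ustarAlgType C} {phi : falg C O -> tens P A}.
Hypothesis hphi : is_ustarhom phi.

Lemma coef_star l (s t : 'I_(bdim l)) k (i j : 'I_(bdim k)) :
  star (coef phi s t i j) = coef phi t s j i.
Proof.
by case: hphi => -[_ _ phis] _; rewrite /coef -(munit_star k i j) phis tens_starE.
Qed.

(** Only the index [r] of the block of [P] is summed, so the result does not depend on [j]; this
    independence later cancels the weight [1 / n_k]. *)
Lemma coef_mul l (s t : 'I_(bdim l)) k (i j j' : 'I_(bdim k)) :
  \sum_r coef phi s r i j ** coef phi r t j j' = coef phi s t i j'.
Proof.
by case: hphi => -[_ phiM _] _; rewrite /coef -tens_mulE -phiM munit_mul.
Qed.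

Lemma coef_one l (s : 'I_(bdim l)) :
  \sum_(k < nblk O) \sum_(i < bdim k) coef phi s s i i = sone.
Proof.
case: hphi => -[phil _ _] phi1.
pose g : {linear falg C O -> tens P A} := HB.pack phi (GRing.isLinear.Build _ _ _ _ phi phil).
have : phi (\sum_(k < nblk O) \sum_(i < bdim k) munit i i) l s s = sone.
  by rewrite munit_one phi1 tens_oneE eqxx.
rewrite -[phi]/(g : _ -> _) linear_sum tens_sumE => <-; apply: eq_bigr => k _.
by rewrite linear_sum tens_sumE.
Qed.

End Coefficients.

(** * Factorizations with values in a subalgebra *)

Section UniversalSubalgebra.
Context {C : numClosedFieldType} {P O : finqspace}.

(** [phi] is corestricted to entries in the subtype of [B]. Its factorization followed by the
    inclusion has values in [B] on all of [M], not only on the coefficients of [Phi]. *)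
Lemma quantum_maps_sub {M A : ucstarAlgType C} {Phi : falg C O -> tens P M}
    {phi : falg C O -> tens P A} (B : @ucsubalg C A) :
  is_quantum_maps Phi -> is_ustarhom phi ->
  (forall l (s t : 'I_(bdim l)) k (i j : 'I_(bdim k)), ucs_set B (coef phi s t i j)) ->
  exists L : M -> A, [/\ is_ustarhom L, phi = tmap L \o Phi & forall m, ucs_set B (L m)].
Proof.
move=> hPhi hphi hB; have [[phil phiM phis] phi1] := hphi.
have phiB x l (s t : 'I_(bdim l)) : ucs_pred B (phi x l s t).
  rewrite (linear_falg phi x phil) tens_sumE.
  apply: rpred_sum => k _; rewrite tens_sumE; apply: rpred_sum => i _.
  rewrite tens_sumE; apply: rpred_sum => j _; rewrite tens_scaleE.
  by apply: rpredZ; apply/asboolP; exact: hB.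
pose psi x : tens P (ucs_sort B) := fun l => \matrix_(s, t) Sub _ (phiB x l s t).
have hpsi : is_ustarhom psi.
  split; first split.
  - move=> c x y; apply: tensP => l s t; rewrite !mxE; apply: val_inj.
    by rewrite SubK phil !mxE.
  - move=> x y; apply: tensP => l s t; rewrite !mxE; apply: val_inj.
    rewrite SubK phiM tens_mulE raddf_sum; apply: eq_bigr => r _.
    by rewrite !mxE.
  - move=> x; apply: tensP => l s t; rewrite !mxE; apply: val_inj.
    by rewrite SubK phis !mxE.
  - apply: tensP => l s t; rewrite !mxE; apply: val_inj.
    by rewrite SubK phi1 tens_oneE; case: eqP.
have [L [[hL LE] _]] := quantum_maps_unital hPhi hpsi.
exists (\val \o L); split; last by move=> m; exact: ucs_valP.
  exact: ustarhom_comp (val_ustarhom B) hL.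
apply/funext => x; apply: tensP => l s t.
have := congr1 (fun f : falg C O -> tens P (ucs_sort B) => \val (f x l s t)) LE.
by rewrite !mxE SubK => ->.
Qed.

End UniversalSubalgebra.

(** * Commutants and centralizers of vector states *)

Section TraceSet.
Context {R : realType} {H : hilbertType R[i]}.
Implicit Types (S : set (bop H)) (xi : H) (a b : bop H).

Definition commutant S : set (bop H) := [set a | forall u, S u -> u ** a = a ** u].

(** The centralizer of the vector state in the commutant of [S]. Testing against the whole commutant
    is what makes it stable under products. *)
Definition trace_set S xi : set (bop H) :=
  [set b | commutant S b /\ forall a, commutant S a ->
     vector_state xi (a ** b) = vector_state xi (b ** a)].

Lemma vector_state_linear xi : linear (vector_state xi : bop H -> R[i]^o).
Proof. by move=> c a b; rewrite /vector_state /= innerDl innerZl. Qed.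

Lemma vector_state_star xi a : vector_state xi (star a) = Num.conj (vector_state xi a).
Proof. by rewrite /vector_state -innerC adjointPl. Qed.

Lemma vector_state_pos xi a : 0 <= vector_state xi (star a ** a).
Proof. by rewrite /vector_state /= [inner _ _]adjointPl inner_norm exprn_ge0. Qed.

Lemma trace_set_closed S xi : (forall u, S u -> S (star u)) ->
  closed_star_subalg (trace_set S xi).
Proof.
move=> Sstar.
have cM a b : commutant S a -> commutant S b -> commutant S (a ** b).
  by move=> ca cb u Su; rewrite smulA ca // -smulA cb // smulA.
have cs a : commutant S a -> commutant S (star a).
  by move=> ca u Su; rewrite -[u]starK -!starM ca //; exact: Sstar.
split.
- split=> [u _|a _]; by rewrite smul0l smul0r.
- move=> c a b [ca ta] [cb tb]; split=> [u Su|d cd].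
    by rewrite smulDl smulDr smulZl smulZr ca // cb.
  by rewrite smulDl smulDr smulZl smulZr !vector_state_linear ta // tb.
- move=> a b [ca ta] [cb tb]; split=> [|d cd]; first exact: cM.
  (* With omega the vector state, [omega (d a b) = omega (b d a) = omega (a b d)], because [d a] and
     [b d] stay in the commutant. *)
  by rewrite smulA tb ?smulA ?ta -?smulA //; exact: cM.
- move=> a [ca ta]; split=> [|d cd]; first exact: cs.
  have := ta _ (cs _ cd); move/(congr1 Num.conj).
  by rewrite -!vector_state_star !starM starK.
- move=> b bcl.
  (* Both defining conditions say that bounded additive maps vanish, so they pass to the closure by
     [closed_ker]. *)
  have ker (V : normedModType R[i]) (f : bop H -> V) k :
      (forall x y, f (x - y) = f x - f y) -> (forall x, `|f x| <= k * `|x|) ->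
      (forall x, trace_set S xi x -> f x = 0) -> f b = 0.
    move=> fB fk f0; apply: (closed_ker f k fB fk); exact: closureS bcl.
  split=> [u Su|a ca]; apply/eqP; rewrite -subr_eq0; apply/eqP.
    apply: (ker _ (fun x => u ** x - x ** u) (`|u| + `|u|)) => [x y|x|x [cx _]].
    - by rewrite smulBr smulBl !opprD !opprK addrACA.
    - rewrite mulrDl; apply: le_trans (ler_normB _ _) _.
      by rewrite lerD // ?cstar_normM // mulrC cstar_normM.
    - by rewrite cx // subrr.
  pose f x : R[i]^o := vector_state xi (a ** x) - vector_state xi (x ** a).
  have stB x y : vector_state xi (x - y) = vector_state xi x - vector_state xi y.
    by rewrite /vector_state -innerBl.
  have st x : `|vector_state xi x| <= `|x| * (`|xi| * `|xi|).
    apply: le_trans (cauchy_schwarz _ _) _; rewrite mulrA ler_wpM2r //.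
    exact: bop_norm_ler.
  apply: (ker R[i]^o f ((`|a| + `|a|) * (`|xi| * `|xi|))) => [x y|x|x [_ tx]].
  - by rewrite /f smulBr smulBl !stB !opprD !opprK addrACA.
  - apply: le_trans (ler_normB _ _) _; rewrite mulrAC !mulrDl; apply: lerD.
      apply: le_trans (st _) _; rewrite ler_wpM2r ?mulr_ge0 //; exact: cstar_normM.
    apply: le_trans (st _) _; rewrite ler_wpM2r ?mulr_ge0 // mulrC; exact: cstar_normM.
  - by rewrite /f tx // subrr.
Qed.

Lemma trace_set_one S xi : trace_set S xi sone.
Proof. by split=> [u _|a _]; rewrite smul1l smul1r. Qed.

(* [a w xi = a u^* xi = u^* a xi], so moving [u] across the inner product and
   using [u xi = w^* xi] turns [omega (a w)] into [omega (w a)]. *)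
Lemma mem_trace_set S xi u w : S (star u) -> commutant S w ->
  w xi = star u xi -> star w xi = u xi -> trace_set S xi w.
Proof.
move=> Su cw wu uw; split=> // a ca.
rewrite /vector_state -[(a ** w) xi]/(a (w xi)) wu -[a (star u xi)]/((a ** star u) xi).
by rewrite -ca // [LHS]adjointPl -uw -adjointP.
Qed.

Lemma trace_on_sub S xi D : D `<=` commutant S -> D `<=` trace_set S xi ->
  trace_on D (vector_state xi).
Proof.
move=> DS DT; split=> [c a b _ _|a _|a b Da Db].
- exact: vector_state_linear.
- exact: vector_state_pos.
- by have [_ h] := DT _ Db; apply: h; exact: DS.
Qed.

End TraceSet.

Lemma tmapE {P : finqspace} {A B : Type} (f : A -> B) (x : tens P A) l s t :
  tmap f x l s t = f (x l s t).
Proof. exact: mxE. Qed.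

(** * Leg numbering in coordinates *)

Section Legs.
Context {C : numClosedFieldType} {P : finqspace} {A : ustarAlgType C}.
Implicit Types x y : tens P A.

Lemma tensor_soneE {V : lmodType C} (a : V) l (s t : 'I_(bdim l)) :
  (tensor sone a : tens P V) l s t = if s == t then a else 0.
Proof. by rewrite mxE tens_oneE; case: eqP => _; rewrite ?scale1r ?scale0r. Qed.

Lemma leg13E x l (s t : 'I_(bdim l)) l' (s' t' : 'I_(bdim l')) :
  leg13 x l s t l' s' t' = if s' == t' then x l s t else 0.
Proof. by rewrite mxE tensor_soneE. Qed.

Lemma leg23E x l (s t : 'I_(bdim l)) l' (s' t' : 'I_(bdim l')) :
  leg23 x l s t l' s' t' = if s == t then x l' s' t' else 0.
Proof. by rewrite tensor_soneE; case: eqP => // _; rewrite mxE. Qed.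

(** The two legs sit in different matrix factors, so each entry of the product collapses to a single
    term; only the order of the two factors in [A] distinguishes it from the opposite product. *)
Lemma leg13_mul_leg23 x y l (s t : 'I_(bdim l)) l' (s' t' : 'I_(bdim l')) :
  (leg13 x ** leg23 y) l s t l' s' t' = x l s t ** y l' s' t'.
Proof.
rewrite tens_mulE tens_sumE (bigD1 t) //= [X in _ + X]big1 => [|r rt]; last first.
  rewrite tens_mulE big1 // => r' _.
  by rewrite leg23E (negbTE rt) smul0r.
rewrite addr0 tens_mulE (bigD1 s') //= [X in _ + X]big1 => [|r rs]; last first.
  by rewrite leg13E eq_sym (negbTE rs) smul0l.
by rewrite addr0 leg13E leg23E !eqxx.
Qed.

Lemma leg23_mul_leg13 x y l (s t : 'I_(bdim l)) l' (s' t' : 'I_(bdim l')) :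
  (leg23 y ** leg13 x) l s t l' s' t' = y l' s' t' ** x l s t.
Proof.
rewrite tens_mulE tens_sumE (bigD1 s) //= [X in _ + X]big1 => [|r rs]; last first.
  rewrite tens_mulE big1 // => r' _.
  by rewrite leg23E eq_sym (negbTE rs) smul0l.
rewrite addr0 tens_mulE (bigD1 t') //= [X in _ + X]big1 => [|r rt]; last first.
  by rewrite leg13E (negbTE rt) smul0r.
by rewrite addr0 leg13E leg23E !eqxx.
Qed.

End Legs.

(** * Sums with the synchronicity weights *)

Section WeightedSum.
Context {C : numClosedFieldType} {P O : finqspace}.

Definition index_fun := forall (k : 'I_(nblk O)) (l : 'I_(nblk P)),
  'I_(bdim k) -> 'I_(bdim k) -> 'I_(bdim l) -> 'I_(bdim l) -> C.
Implicit Types F G : index_fun.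

(** The weighting of [synchronous] applied to an arbitrary family, so that squared norms and inner
    products are summed with the same positive weights. *)
Definition wsum F : C :=
  \sum_(k < nblk O) \sum_(l < nblk P) \sum_(i < bdim k) \sum_(j < bdim k)
    \sum_(s < bdim l) \sum_(t < bdim l)
      ((bdim k)%:R * (bdim l)%:R)^-1 * F k l i j s t.

Lemma eq_wsum F G : (forall k l i j s t, F k l i j s t = G k l i j s t) ->
  wsum F = wsum G.
Proof. by move=> FG; do 6 (apply: eq_bigr => ? _); rewrite FG. Qed.

Lemma wsumD F G :
  wsum (fun k l i j s t => F k l i j s t + G k l i j s t) = wsum F + wsum G.
Proof.
by rewrite /wsum; do 6 (rewrite -big_split; apply: eq_bigr => ? _); rewrite mulrDr.
Qed.

Lemma wsumN F : wsum (fun k l i j s t => - F k l i j s t) = - wsum F.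
Proof.
by rewrite /wsum; do 6 (rewrite -sumrN; apply: eq_bigr => ? _); rewrite mulrN.
Qed.

Lemma wsum_conj F :
  wsum (fun k l i j s t => Num.conj (F k l i j s t)) = Num.conj (wsum F).
Proof.
rewrite /wsum; do 6 (rewrite rmorph_sum; apply: eq_bigr => ? _).
by rewrite rmorphM fmorphV rmorphM !rmorph_nat.
Qed.

(** The weights depend on [k] and [l] only, so transposing both index pairs is a reindexing. *)
Lemma wsum_swap F :
  wsum (fun k l i j s t => F k l j i t s) = wsum F.
Proof.
apply: eq_bigr => k _; apply: eq_bigr => l _; rewrite exchange_big.
by do 2 (apply: eq_bigr => ? _); rewrite exchange_big.
Qed.

Lemma wsum_eq0 F : (forall k l i j s t, 0 <= F k l i j s t) -> wsum F = 0 ->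
  forall k l i j s t, F k l i j s t = 0.
Proof.
move=> F0 h k l i j s t.
have n0 : ((bdim k)%:R * (bdim l)%:R)^-1 != 0 :> C.
  by rewrite invr_eq0 mulf_neq0 // pnatr_eq0 -lt0n bdim_gt0.
have T0 k' l' i' j' s' t' :
    0 <= ((bdim k')%:R * (bdim l')%:R)^-1 * F k' l' i' j' s' t'.
  by rewrite mulr_ge0 // invr_ge0 mulr_ge0.
apply/(mulfI n0); rewrite mulr0.
have sum0 (I : finType) (G : I -> C) :
    (forall a, 0 <= G a) -> \sum_a G a = 0 -> forall a, G a = 0.
  by move=> G0 G1 a; apply: (psumr_eq0P _ G1).
(* The six sums are peeled off from the outermost inwards, every partial sum being non-negative. *)
apply: (sum0 _ _ _ (sum0 _ _ _ (sum0 _ _ _ (sum0 _ _ _ (sum0 _ _ _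
  (sum0 _ _ _ h k) l) i) j) s) t) => *; by do ?[apply: sumr_ge0 => ? _].
Qed.

End WeightedSum.

(** * The consequence of synchronicity for the two families *)

Section Synchronous.
Context {R : realType} {P O : finqspace} {H : hilbertType R[i]}.
Implicit Types phi : falg R[i] O -> tens P (bop H).

(** By [coef_mul] the sum over [t] gives the diagonal coefficient at [s], [i], whatever [j] is, so
    the sum over [j] cancels [1 / n_k]. By [coef_one] the sum over [k] and [i] gives 1, and the sum
    over [s] cancels [1 / m_l]. Each block of [P] thus contributes 1. *)
Lemma wsum_coef_star phi (xi : H) : is_ustarhom phi -> `|xi| = 1 ->
  wsum (fun k l i j s t =>
    vector_state xi (coef phi (l := l) s t (k := k) i j ** coef phi t s j i))
  = (nblk P)%:R.
Proof.
move=> hphi xi1.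
pose om : {linear bop H -> R[i]^o} := HB.pack (vector_state xi : bop H -> R[i]^o)
  (GRing.isLinear.Build _ _ _ _ _ (vector_state_linear xi)).
have nz (Q : finqspace) (l : 'I_(nblk Q)) : (bdim l)%:R != 0 :> R[i].
  by rewrite pnatr_eq0 -lt0n bdim_gt0.
transitivity (\sum_(k < nblk O) \sum_(l < nblk P) \sum_(i < bdim k)
    \sum_(s < bdim l) (bdim l)%:R^-1 * om (coef phi s s i i)).
  apply: eq_bigr => k _; apply: eq_bigr => l _; apply: eq_bigr => i _.
  rewrite exchange_big; apply: eq_bigr => s _ /=.
  rewrite (eq_bigr (fun=> ((bdim k)%:R * (bdim l)%:R)^-1 * om (coef phi s s i i))).
    rewrite sumr_const card_ord -[LHS]mulr_natl mulrA; congr (_ * _).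
    by rewrite invfM mulrA mulfV ?mul1r.
  move=> j _; rewrite -mulr_sumr -(coef_mul hphi _ s s _ i j i); congr (_ * _).
  by rewrite linear_sum.
rewrite exchange_big /=.
transitivity (\sum_(l < nblk P) \sum_(s < bdim l) ((bdim l)%:R^-1 : R[i])).
  apply: eq_bigr => l _.
  transitivity (\sum_(k < nblk O) \sum_(s < bdim l) \sum_(i < bdim k)
      (bdim l)%:R^-1 * om (coef phi s s i i)).
    by apply: eq_bigr => k _; rewrite exchange_big.
  rewrite exchange_big; apply: eq_bigr => s _ /=.
  transitivity ((bdim l)%:R^-1 * om sone : R[i]); last first.
    by rewrite [om sone]inner_norm xi1 expr1n mulr1.
  rewrite -(coef_one hphi _ s) linear_sum mulr_sumr; apply: eq_bigr => k _.
  by rewrite linear_sum mulr_sumr.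
rewrite (eq_bigr (fun=> 1)) => [|l _]; first by rewrite sumr_const card_ord.
by rewrite sumr_const card_ord -[LHS]mulr_natl mulfV.
Qed.

Context {T : tens O (falg R[i] O) -> tens P (falg R[i] P)}.
Context {Phi1 Phi2 : falg R[i] O -> tens P (bop H)} {xi : H}.
Hypothesis hreal : is_realization T Phi1 Phi2 xi.

Lemma realization_coefE l (s t : 'I_(bdim l)) l' (s' t' : 'I_(bdim l'))
    k (i j : 'I_(bdim k)) k' (i' j' : 'I_(bdim k')) :
  corr_coef T s t s' t' i j i' j' =
  vector_state xi (coef Phi1 s t i j ** coef Phi2 s' t' i' j').
Proof. by case: hreal => _ _ _ _ TE; rewrite /corr_coef TE !tmapE leg13_mul_leg23. Qed.

Lemma realization_commute l (s t : 'I_(bdim l)) l' (s' t' : 'I_(bdim l'))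
    k (i j : 'I_(bdim k)) k' (i' j' : 'I_(bdim k')) :
  coef Phi1 s t i j ** coef Phi2 s' t' i' j' =
  coef Phi2 s' t' i' j' ** coef Phi1 s t i j.
Proof.
case: hreal => _ _ comm _ _; have := comm (munit i j) (munit i' j').
move=> /(congr1 (fun z : tens P (tens P (bop H)) => z l s t l' s' t')).
by rewrite leg13_mul_leg23 leg23_mul_leg13.
Qed.

(** The equality case is obtained by showing that the weighted sum of the squared norms of the
    differences [d] is zero; each term then vanishes by [wsum_eq0]. *)
Lemma synchronous_coef l (s t : 'I_(bdim l)) k (i j : 'I_(bdim k)) :
  synchronous T -> coef Phi2 s t i j xi = star (coef Phi1 s t i j) xi.
Proof.
move=> hsync; have [h1 h2 _ xi1 _] := hreal.
pose U k l i j s t := coef Phi1 (l := l) s t (k := k) i j.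
pose W k l i j s t := coef Phi2 (l := l) s t (k := k) i j.
pose X k l i j s t := vector_state xi (U k l i j s t ** W k l i j s t).
pose d k l i j s t := W k l i j s t xi - star (U k l i j s t) xi.
have dE k' l' i' j' s' t' : inner (d k' l' i' j' s' t') (d k' l' i' j' s' t') =
    vector_state xi (W k' l' j' i' t' s' ** W k' l' i' j' s' t') +
    vector_state xi (U k' l' i' j' s' t' ** U k' l' j' i' t' s') +
    - (X k' l' i' j' s' t' + Num.conj (X k' l' i' j' s' t')).
  set u := U k' l' i' j' s' t'; set w := W k' l' i' j' s' t'.
  have -> : U k' l' j' i' t' s' = star u by rewrite [RHS](coef_star h1).
  have -> : W k' l' j' i' t' s' = star w by rewrite [RHS](coef_star h2).
  rewrite /d -/u -/w innerBl !innerBr /X -/u -/w /vector_state -innerC /=.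
  rewrite -[star w (w xi)]/(adjoint w (w xi)) -[star u]/(adjoint u).
  rewrite !adjointPl !adjointP.
  by rewrite adjointK opprB addrACA -opprD.
(* The two squared norms contribute [N_P] each, and the cross terms remove [N_P] and its
   conjugate. *)
have dsum : wsum (fun k l i j s t => inner (d k l i j s t) (d k l i j s t)) = 0.
  rewrite (eq_wsum _ _ dE) wsumD wsumD wsumN wsumD wsum_conj.
  rewrite (wsum_swap (fun k l i j s t =>
    vector_state xi (W k l i j s t ** W k l j i t s))).
  rewrite !wsum_coef_star //.
  have -> : wsum X = (nblk P)%:R.
    rewrite -hsync; do 6 (apply: eq_bigr => ? _).
    by rewrite realization_coefE.
  by rewrite conjC_nat subrr.
have := wsum_eq0 _ _ dsum k l i j s t.
rewrite inner_norm => h; apply/eqP; rewrite -subr_eq0 -normr_eq0.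
rewrite -sqrf_eq0 h // => *; by rewrite inner_norm exprn_ge0.
Qed.

End Synchronous.

(** * Linear maps determined on pairs of matrix units *)

Section BiTensor.
Context {C : numClosedFieldType}.

Lemma tensor_linear {P : finqspace} {V : lmodType C} (x : falg C P) :
  linear (tensor x : V -> tens P V).
Proof.
move=> c v w; apply: tensP => l s t; rewrite !mxE scalerDr !scalerA.
by congr (_ *: _ + _); exact: mulrC.
Qed.

Lemma bitensor_sum {P Q : finqspace} (z : tens P (falg C Q)) :
  z = \sum_l \sum_s \sum_t \sum_l' \sum_s' \sum_t'
        (z l s t l' s' t' : C) *: tensor (munit s t) (munit s' t').
Proof.
rewrite [LHS]tens_munit; do 3 (apply: eq_bigr => ? _).
exact: linear_falg (tensor_linear _).
Qed.

Lemma linear_bitensor {P Q : finqspace} {V : lmodType C} (f : tens P (falg C Q) -> V) z :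
  linear f ->
  f z = \sum_l \sum_s \sum_t \sum_l' \sum_s' \sum_t'
        (z l s t l' s' t' : C) *: f (tensor (munit s t) (munit s' t')).
Proof.
move=> fl; pose g : {linear tens P (falg C Q) -> V} :=
  HB.pack f (GRing.isLinear.Build _ _ _ _ f fl).
rewrite [in LHS](bitensor_sum z) -[f]/(g : _ -> _).
by do 6 (rewrite linear_sum; apply: eq_bigr => ? _); rewrite linearZ.
Qed.

End BiTensor.

(** * Traces on the generated algebras and on C(M), and recovery of the correlation *)

Theorem theorem6p6 (R : realType) (P O : finqspace) (H : hilbertType R[i])
    (M : ucstarAlgType R[i]) (Phi : falg R[i] O -> tens P M)
    (T : tens O (falg R[i] O) -> tens P (falg R[i] P))
    (Phi1 Phi2 : falg R[i] O -> tens P (bop H)) (xi : H)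
    (hPhi : is_quantum_maps Phi)
    (hT : is_correlation T)
    (hreal : is_realization T Phi1 Phi2 xi)
    (hsync : synchronous T) :
  [/\ forall (l : 'I_(nblk P)) (s t : 'I_(bdim l))
         (k : 'I_(nblk O)) (i j : 'I_(bdim k)),
         coef Phi2 s t i j xi = star (coef Phi1 s t i j) xi,
      trace_on (cstar_generated
          [set a | exists l (s t : 'I_(bdim l)) k (i j : 'I_(bdim k)),
                     a = coef Phi2 s t i j])
        (vector_state xi),
      trace_on (cstar_generated
          [set a | exists l (s t : 'I_(bdim l)) k (i j : 'I_(bdim k)),
                     a = coef Phi1 s t i j])
        (vector_state xi) &
      exists Lam1 : M -> bop H,
        [/\ unique (fun L => is_ustarhom L /\ Phi1 = tmap L \o Phi) Lam1,
            is_state (vector_state xi \o Lam1),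
            trace_on setT (vector_state xi \o Lam1) &
            T = corr_of Phi (vector_state xi \o Lam1)]].
Proof.
have [h1 h2 _ xi1 _] := hreal; have [Tlin _ _] := hT.
have WU l s t k i j := @synchronous_coef R P O H T Phi1 Phi2 xi hreal l s t k i j hsync.
(* Flipping both index pairs makes the relation symmetric in the two families, so one argument
   serves both traces. *)
have UW l (s t : 'I_(bdim l)) k (i j : 'I_(bdim k)) :
    coef Phi1 s t i j xi = star (coef Phi2 s t i j) xi.
  by rewrite (coef_star h2) WU (coef_star h1).
set SW := [set a | exists l (s t : 'I_(bdim l)) k (i j : 'I_(bdim k)),
                     a = coef Phi2 s t i j].
set SU := [set a | exists l (s t : 'I_(bdim l)) k (i j : 'I_(bdim k)),
                     a = coef Phi1 s t i j].
have starW a : SW a -> SW (star a).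
  by move=> [l [s [t [k [i [j ->]]]]]]; exists l, t, s, k, j, i; exact: coef_star.
have starU a : SU a -> SU (star a).
  by move=> [l [s [t [k [i [j ->]]]]]]; exists l, t, s, k, j, i; exact: coef_star.
have comm u w : SU u -> SW w -> u ** w = w ** u.
  move=> [l [s [t [k [i [j ->]]]]]] [l' [s' [t' [k' [i' [j' ->]]]]]].
  exact: realization_commute hreal _ _ _ _ _ _ _ _ _ _ _ _.
have subW : SW `<=` trace_set SU xi.
  move=> a Sa; have := Sa => -[l [s [t [k [i [j aE]]]]]].
  apply: (mem_trace_set SU xi (coef Phi1 s t i j)).
  - by apply: starU; exists l, s, t, k, i, j.
  - by move=> u Su; exact: comm.
  - by rewrite aE.
  - by rewrite aE.
have subU : SU `<=` trace_set SW xi.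
  move=> a Sa; have := Sa => -[l [s [t [k [i [j aE]]]]]].
  apply: (mem_trace_set SW xi (coef Phi2 s t i j)).
  - by apply: starW; exists l, s, t, k, i, j.
  - by move=> w Sw; exact/esym/comm.
  - by rewrite aE.
  - by rewrite aE.
have trU := trace_set_closed SU xi starU.
have trW := trace_set_closed SW xi starW.
split=> //.
(* [trace_set SU xi] is a closed star-subalgebra containing the generators, hence contains the
   C*-algebra they generate. *)
- apply: (trace_on_sub SU) => a Da; have [] := smallest_sub trU subW Da => //.
- apply: (trace_on_sub SW) => a Da; have [] := smallest_sub trW subU Da => //.
have [|L [hL LE LB]] :=
    @quantum_maps_sub _ P O M _ Phi Phi1 (UCSubalg _ trW (trace_set_one SW xi)) hPhi h1.
  by move=> l s t k i j; apply: subU; exists l, s, t, k, i, j.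
have coefL l (s t : 'I_(bdim l)) k (i j : 'I_(bdim k)) :
    coef Phi1 s t i j = L (coef Phi s t i j) by rewrite /coef LE /= tmapE.
have [[Llin LM Ls] L1] := hL.
exists L; split.
(* Uniqueness is taken with target B(H): [L] and any competitor both equal [L0]. *)
- have [L0 [_ uniq0]] := quantum_maps_unital hPhi h1.
  split=> // L' hL'; rewrite -(uniq0 _ hL'); symmetry; exact: uniq0.
- split=> [c a b|a|] /=.
  + by rewrite Llin vector_state_linear.
  + by rewrite LM Ls vector_state_pos.
  + by rewrite L1 /vector_state inner_norm xi1 expr1n.
- split=> [c a b _ _|a _|a b _ _] /=.
  + by rewrite Llin vector_state_linear.
  + by rewrite LM Ls vector_state_pos.
  (* [LB b] gives the trace identity against the commutant of [SW], and [LB a] places [L a] in that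
     commutant. *)
  + by rewrite !LM; have [_] := LB b; apply; have [] := LB a.
- apply/funext => z; rewrite (linear_bitensor T z Tlin).
  do 6 (apply: eq_bigr => ? _); congr (_ *: _).
  rewrite [LHS]bitensor_sum; do 6 (apply: eq_bigr => ? _); congr (_ *: _).
  rewrite [LHS](realization_coefE hreal) /= LM -!coefL.
  (* Replacing [W xi] by the adjoint of [U] applied to [xi] produces the transposed indices in the
     second factor of T_tau. *)
  by rewrite /vector_state /= WU (coef_star h1).
Qed.
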